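(* Let $H$ be a finite hypergraph with no Berge cycle of length congruent to $0$ or $1$ modulo $3$. Then either $I(H)$ is homology equivalent to a contractible space, or $I(H)$ is homology equivalent to the sphere $S^{\gamma(H)-1}$.
   Context: A hypergraph $H$ on a finite vertex set $V(H)$ is a collection of nonempty subsets (edges) of $V(H)$. An independent set of $H$ is a vertex subset containing no edge of $H$; the independence complex $I(H)$ is the simplicial complex of independent sets. A Berge cycle of length $k$ is an alternating sequence $v_1e_1v_2e_2\ldots v_ke_k$ of distinct vertices and distinct edges with $v_i,v_{i+1}\in e_i$ for all $i$ (indices mod $k$). Two complexes are homology equivalent if they have isomorphic reduced integral homology groups in all dimensions. It is known that if $H$ has no Berge cycle of length $0$ modulo $3$ then $I(H)$ is homology equivalent to a contractible space or to a sphere. A vertex $v$ is dominated by $W\subseteq V(H)$ if $v\in W$ or $\{v\}\cup W'\in H$ for some $W'\subseteq W$; $W$ is a dominating set if it dominates every vertex, and $\gamma(H)$ is the minimum size of a dominating set. *)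

(* Defs.v *)
From HB Require Import structures.
From mathcomp Require Import all_boot all_order all_algebra.
From mathcomp Require Import boolp.

Set Implicit Arguments.
Unset Strict Implicit.
Unset Printing Implicit Defensive.

Import GRing.Theory.

Local Open Scope ring_scope.

Record hypergraph (V : finType) := Hypergraph {
  edges :> {set {set V}};
  edges_neq0 : set0 \notin edges }.

(* Lengths below 2 are excluded: with k = 1 every edge would be a cycle. *)
Definition has_berge_cycle (V : finType) (H : hypergraph V) (k : nat) : Prop :=
  (2 <= k)%N /\
  exists (v : 'I_k -> V) (e : 'I_k -> {set V}),
    [/\ injective v, injective e &
        forall i, [/\ e i \in edges H, v i \in e i & v (ordS i) \in e i]].

(* In [v |: W' \in edges H], W' may be empty: a vertex carrying a singleton
   edge is dominated by every set. *)
Definition dominates (V : finType) (H : hypergraph V) (W : {set V}) (v : V) :=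
  (v \in W) || [exists W' : {set V}, (W' \subset W) && (v |: W' \in edges H)].

Definition dominating (V : finType) (H : hypergraph V) (W : {set V}) : bool :=
  [forall v, dominates H W v].

Definition gamma (V : finType) (H : hypergraph V) : nat :=
  #|[arg min_(W < [set: V] | dominating H W) #|W| ]|.

Lemma dominating_setT (V : finType) (H : hypergraph V) :
  dominating H [set: V].
Proof. by apply/forallP => v; rewrite /dominates inE. Qed.

Record complex (V : finType) := Complex {
  faces :> {set {set V}};
  faces_sub : forall F G : {set V}, F \in faces -> G \subset F -> G \in faces }.

Definition independent (V : finType) (H : hypergraph V) (S : {set V}) : bool :=
  [forall e in edges H, ~~ (e \subset S)].

Lemma indep_sub (V : finType) (H : hypergraph V) (F G : {set V}) :
  F \in [set S | independent H S] -> G \subset F ->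
  G \in [set S | independent H S].
Proof.
rewrite !inE => /forall_inP iF GF; apply/forall_inP => e eH.
by apply: contra (iF e eH) => /subset_trans; apply.
Qed.

Definition indep_complex (V : finType) (H : hypergraph V) : complex V :=
  Complex (@indep_sub V H).

Lemma point_sub (F G : {set unit}) :
  F \in [set: {set unit}] -> G \subset F -> G \in [set: {set unit}].
Proof. by rewrite !inE. Qed.

Definition point : complex unit := Complex point_sub.

Lemma sphere_sub n (F G : {set 'I_n.+1}) :
  F \in [set S : {set 'I_n.+1} | S != setT] -> G \subset F ->
  G \in [set S : {set 'I_n.+1} | S != setT].
Proof.
rewrite !inE => FT GF; apply: contra FT => /eqP GT.
by rewrite -subTset -GT.
Qed.

(* The boundary of the n-simplex, a triangulation of the sphere of dimension
   n - 1; [sphere 0] has the empty set as its only face. *)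
Definition sphere (n : nat) : complex 'I_n.+1 := Complex (@sphere_sub n).

(* Reduced simplicial homology over the integers.  All the chain groups live
   in the single group {ffun {set V} -> int}, and they are graded by the
   cardinality n of the faces, i.e. n is one more than the dimension; the
   empty face (n = 0) gives the augmentation. *)
Definition chain (V : finType) (K : complex V) (n : nat)
    (c : {ffun {set V} -> int}) : bool :=
  [forall F, (c F != 0) ==> (F \in faces K) && (#|F| == n)].

(* The coefficient of F in the boundary of v |: F (for v outside F) is
   (-1) ^ i, where i is the position of v in v |: F in the order of enum V. *)
Definition bd (V : finType) (c : {ffun {set V} -> int}) :
    {ffun {set V} -> int} :=
  [ffun F : {set V} => \sum_(v | v \notin F)
     (-1) ^+ #|[set u in F | (enum_rank u < enum_rank v)%N]| * c (v |: F)].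

Definition cycle_pred (V : finType) (K : complex V) (n : nat) :
    {pred {ffun {set V} -> int}} :=
  fun c => chain K n c && (bd c == 0).

Lemma chain0 (V : finType) (K : complex V) n : chain K n 0.
Proof. by apply/forallP => F; rewrite ffunE eqxx. Qed.

Lemma chainB (V : finType) (K : complex V) n c d :
  chain K n c -> chain K n d -> chain K n (c - d).
Proof.
move=> /forallP hc /forallP hd; apply/forallP => F; apply/implyP.
rewrite !ffunE => nz; have [c0|/(implyP (hc F))//] := eqVneq (c F) 0.
by apply: (implyP (hd F)); apply: contraNneq nz => ->; rewrite c0 subrr.
Qed.

Lemma bdB (V : finType) (c d : {ffun {set V} -> int}) :
  bd (c - d) = bd c - bd d.
Proof.
apply/ffunP => F; rewrite !ffunE -sumrB; apply: eq_bigr => v _.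
by rewrite !ffunE mulrBr.
Qed.

Lemma bd0 (V : finType) : bd (0 : {ffun {set V} -> int}) = 0.
Proof. by rewrite -[X in bd X](subrr 0) bdB subrr. Qed.

Lemma cycle_closed (V : finType) (K : complex V) n :
  zmod_closed (cycle_pred K n).
Proof.
split=> [|c d]; rewrite !unfold_in /cycle_pred; first by rewrite chain0 bd0 /=.
move=> /andP[cc /eqP c0] /andP[cd /eqP d0].
by rewrite chainB // bdB c0 d0 subrr /=.
Qed.

HB.instance Definition _ (V : finType) (K : complex V) (n : nat) :=
  GRing.isZmodClosed.Build _ (cycle_pred K n) (cycle_closed K n).

Record cycles (V : finType) (K : complex V) (n : nat) := Cycle {
  cycle_val : {ffun {set V} -> int};
  _ : cycle_val \in cycle_pred K n }.

HB.instance Definition _ (V : finType) (K : complex V) (n : nat) :=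
  [isSub for @cycle_val V K n].
HB.instance Definition _ (V : finType) (K : complex V) (n : nat) :=
  [Choice of cycles K n by <:].
HB.instance Definition _ (V : finType) (K : complex V) (n : nat) :=
  [SubChoice_isSubZmodule of cycles K n by <:].

Definition boundaries (V : finType) (K : complex V) (n : nat) :
    {pred cycles K n} :=
  fun z => `[< exists2 b, chain K n.+1 b & bd b = val z >].

Lemma boundaries_closed (V : finType) (K : complex V) n :
  zmod_closed (@boundaries V K n).
Proof.
split=> [|y z]; rewrite !unfold_in /boundaries.
  by apply/asboolP; exists 0; [exact: chain0 | exact: bd0].
move=> /asboolP[b cb eb] /asboolP[c cc ec]; apply/asboolP.
by exists (b - c); [exact: chainB | rewrite bdB eb ec].
Qed.

HB.instance Definition _ (V : finType) (K : complex V) (n : nat) :=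
  GRing.isZmodClosed.Build _ (@boundaries V K n) (boundaries_closed K n).

(* [homology K n] is the reduced homology group of K in dimension n - 1. *)
Definition homology (V : finType) (K : complex V) (n : nat) : zmodType :=
  Quotient.quot (@boundaries V K n).

Definition homology_equiv (V W : finType) (K : complex V) (L : complex W) :
    Prop :=
  forall n : nat,
    exists f : {additive homology K n -> homology L n}, bijective f.

(* Main.v *)
(* Let B be the incidence graph of H, with a node for every vertex and every
   edge. The complements of the independent sets of B span a chain complex, and
   pairing Q with Q :|: [set e] or Q :\ e for the edges e of H shows that it has
   the homology of I(H) up to a shift. By hypothesis all cycles of B have length
   1 mod 3, and a set W dominates H iff its complement is one side of an induced
   matching of B. So it suffices to show, for every graph all of whose cycles
   have length 1 mod 3, that the complex is acyclic or has the homology of a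
   sphere whose dimension is given by the maximal size m of an induced matching.

   This is an induction on the number of nodes. A longest path argument shows
   that a nonempty graph of this kind contains an isolated node, or nodes u != w
   with N(u) included in N(w), or a component with two nodes, or two adjacent
   nodes p, q of degree 2. An isolated node makes the complex acyclic; in the
   other cases one may delete w, delete the component, or contract the path
   a - p - q - b through p and q to a node. The last two decrease m by one. When
   the deletion of w decreases m, a maximum induced matching avoids u and its
   neighbours, and the exact sequence for the deletion and the link of u shows
   that the complex is acyclic. *)
Require Import Defs.
From HB Require Import structures.
From mathcomp Require Import all_boot all_order all_algebra.
From mathcomp Require Import generic_quotient boolp.
From mathcomp Require Import zify ring.

Set Implicit Arguments.
Unset Strict Implicit.
Unset Printing Implicit Defensive.

Import GRing.Theory.

(** * Chain complexes spanned by families of sets *)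

Local Open Scope ring_scope.

(** * Subquotients that are zero or infinite cyclic *)

Section Subquotient.

(** After the edge nodes have been toggled, only those independent sets U of B survive whose
    vertices meet every edge of H. Such a U contains no edge node, and the vertices outside it form
    an independent set of H. Hence the complements are the faces of I(H), all enlarged by the same
    nodes: a complex for the cohomology of I(B) becomes one for the homology of I(H), an instance of
    Alexander duality that never has to be stated.

    A Berge cycle of length k is a cycle of length 2k in B, and excluding k = 0, 1 modulo 3 leaves
    2k = 1. This residue is rigid: three disjoint paths between two nodes have 1 modulo 3 inner
    nodes each, so cycles have no chords. It also survives the contraction, which shortens cycles by
    0 or 3.

    The delicate case is a deletion of w that lowers m, because the homology then sits in a degree
    that does not fit the larger m. The induction therefore ties the degree to m throughout, so that
    the deletion and the link of u are known to vanish in that degree. *)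

Definition trivial_quotient (M : zmodType) (Z B : M -> Prop) :=
  forall c, Z c -> B c.

(** The last clause gives the generator [z] infinite order, so that Z/B is isomorphic to the
    integers. Working with representatives postpones quotient groups to the end. *)
Definition cyclic_quotient (M : zmodType) (Z B : M -> Prop) :=
  exists z, [/\ Z z, forall c, Z c -> exists k : int, B (c - z *~ k)
              & forall k : int, B (z *~ k) -> k = 0].

Lemma trivial_not_cyclic (M : zmodType) (Z B : M -> Prop) :
  trivial_quotient Z B -> cyclic_quotient Z B -> False.
Proof.
move=> tB [z [Zz _ /(_ 1)]]; rewrite mulr1z => z1.
by have := z1 (tB _ Zz).
Qed.

(** The last three hypotheses say that [f] induces a map from Z/B to Z'/B' that is well defined,
    injective and surjective. *)
Lemma quasi_iso (M M' : zmodType) (f : M -> M') (Z B : M -> Prop)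
    (Z' B' : M' -> Prop) :
    {morph f : x y / x - y} -> Z 0 -> B' 0 ->
    (forall x y, Z x -> Z y -> Z (x - y)) ->
    (forall x y, B' x -> B' y -> B' (x - y)) ->
    (forall c, Z c -> Z' (f c)) -> (forall c, Z c -> B c <-> B' (f c)) ->
    (forall c', Z' c' -> exists2 c, Z c & B' (c' - f c)) ->
  (trivial_quotient Z B <-> trivial_quotient Z' B') /\
  (cyclic_quotient Z B <-> cyclic_quotient Z' B').
Proof.
move=> fB Z0 B'0 ZB B'B fZ fBi fs.
pose fa : {additive M -> M'} := HB.pack f (GRing.isZmodMorphism.Build _ _ f fB).
have fMz x k : f (x *~ k) = f x *~ k by rewrite -[f]/(fa : M -> M') raddfMz.
have B'D x y : B' x -> B' y -> B' (x + y).
  by move=> Bx By; rewrite -[y]opprK -[- y]sub0r; apply: (B'B) => //; apply: (B'B).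
have ZN x : Z x -> Z (- x).
  by move=> Zx; rewrite -sub0r; apply: ZB.
have ZMz x k : Z x -> Z (x *~ k).
  move=> Zx; have Zn n : Z (x *+ n).
    elim: n => [|n IH]; first exact: Z0.
    by rewrite mulrSr -[x in _ + x]opprK; apply: ZB => //; apply: ZN.
  by case: k => n; [exact: Zn | rewrite NegzE mulrNz; apply/ZN/Zn].
split; split.
- move=> t c' Zc'; have [c Zc Bc] := fs _ Zc'.
  rewrite -(subrK (f c) c'); apply: B'D => //.
  by apply/fBi/t.
- by move=> t c Zc; apply/fBi => //; apply/t/fZ.
- move=> [z [Zz gz iz]]; exists (f z); split; first exact: fZ.
    move=> c' Zc'; have [c Zc Bc] := fs _ Zc'; have [k Bk] := gz _ Zc.
    exists k; rewrite -(subrK (f c) c') -addrA; apply: B'D => //.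
    by rewrite -fMz -fB; apply/fBi => //; apply: ZB => //; apply: ZMz.
  by move=> k; rewrite -fMz => /fBi Bk; apply: iz; apply: Bk; apply: ZMz.
- move=> [z' [Zz' gz iz]]; have [z Zz Bz] := fs _ Zz'.
  have BMz k : B' ((z' - f z) *~ k).
    have Bn n : B' ((z' - f z) *+ n).
      by elim: n => [|n IH]; [exact: B'0 | rewrite mulrSr; apply: B'D].
    case: k => n; first exact: Bn.
    by rewrite NegzE mulrNz -sub0r; apply: B'B; [exact: B'0 | exact: Bn].
  exists z; split=> //.
    move=> c Zc; have [k Bk] := gz _ (fZ _ Zc); exists k.
    apply/fBi; first by apply: ZB => //; apply: ZMz.
    rewrite fB fMz; have -> : f c - f z *~ k = (f c - z' *~ k) + (z' - f z) *~ k.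
      by rewrite mulrzBl addrA subrK.
    exact: B'D.
  move=> k /fBi Bk; apply: iz; rewrite -(subrK (f z) z') mulrzDl.
  by apply: B'D => //; rewrite -fMz; apply: Bk; apply: ZMz.
Qed.

End Subquotient.

Lemma ffunMzE (aT : finType) (M : zmodType) (c : {ffun aT -> M}) (k : int) x :
  (c *~ k) x = c x *~ k.
Proof. by case: k => n; rewrite ?NegzE ?mulrNz ?ffunE /= ?ffunMnE. Qed.

(** * Boundary operators on families of sets *)

Section Boundary.
Variables (T : finType) (r : T -> nat).
Hypothesis r_inj : injective r.
Implicit Types (X Y Z : {set {set T}}) (F G : {set T}) (u v w : T).
Implicit Types (c b : {ffun {set T} -> int}).

(** The rank [r] is arbitrary, since the same theory is applied to the vertices of H and to the
    nodes of its incidence graph. *)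
Definition sgn F v : int := (-1) ^+ #|[set u in F | (r u < r v)%N]|.

Definition restrict X c : {ffun {set T} -> int} :=
  [ffun F => if F \in X then c F else 0].

Definition fbd c : {ffun {set T} -> int} :=
  [ffun F : {set T} => \sum_(v | v \notin F) sgn F v * c (v |: F)].

(* The boundary of the chain complex spanned by X, a subquotient of the
   complex of the full simplex when X is convex. *)
Definition rbd X c := restrict X (fbd c).

Definition convex X :=
  forall F G K, F \in X -> K \in X -> F \subset G -> G \subset K -> G \in X.

Definition supported X n c := forall F, c F != 0 -> F \in X /\ #|F| = n.

Definition is_cycle X n c := supported X n c /\ rbd X c = 0.

Definition is_boundary X n c := exists2 b, supported X n.+1 b & rbd X b = c.

Lemma sgnU F v u : v \notin F ->
  sgn (v |: F) u = (-1) ^+ (r v < r u)%N * sgn F u.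
Proof.
move=> vF; rewrite /sgn -exprD; congr (_ ^+ _).
have -> : [set u0 in v |: F | (r u0 < r u)%N] =
    (if (r v < r u)%N then [set v] else set0) :|: [set u0 in F | (r u0 < r u)%N].
  apply/setP => x; case: ifP => lt; rewrite !inE.
    by case: eqVneq => [->|]; rewrite ?lt.
  by case: eqVneq => [->|]; rewrite ?lt ?andbF.
case: ifP => lt; last by rewrite set0U.
by rewrite cardsU1 inE (negPf vF).
Qed.

Lemma sgn_sqr F v : sgn F v * sgn F v = 1.
Proof. by rewrite /sgn -exprD addnn -mul2n exprM sqrrN !expr1n. Qed.

(** Exactly one of [r u < r v] and [r v < r u] holds, so exactly one of the two products picks up a
    sign. *)
Lemma sgn_swap F u v : u != v -> u \notin F -> v \notin F ->
  sgn F v * sgn (v |: F) u = - (sgn F u * sgn (u |: F) v).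
Proof.
move=> uv uF vF; rewrite !sgnU //.
have : r u != r v by rewrite (inj_eq r_inj).
by rewrite neq_ltn; case: ltngtP => // _ _; rewrite ?expr0 ?expr1; ring.
Qed.

Lemma fbdB : {morph fbd : x y / x - y}.
Proof.
move=> x y; apply/ffunP => F; rewrite !ffunE -sumrB; apply: eq_bigr => v _.
by rewrite !ffunE mulrBr.
Qed.

Lemma restrictB X : {morph restrict X : x y / x - y}.
Proof. by move=> x y; apply/ffunP => F; rewrite !ffunE; case: ifP; rewrite ?subr0. Qed.

Lemma rbdB X : {morph rbd X : x y / x - y}.
Proof. by move=> x y; rewrite /rbd fbdB restrictB. Qed.

Lemma fbd_fbd c : fbd (fbd c) = 0.
Proof.
apply/ffunP => F; rewrite [RHS]ffunE; set x := LHS.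
(* Exchanging the two added elements negates the double sum, by [sgn_swap]. *)
suff : x = - x by lia.
have xE : x = \sum_v \sum_w (if (v \notin F) && (w \notin F) && (w != v)
    then sgn F v * sgn (v |: F) w * c (w |: (v |: F)) else 0).
  rewrite /x ffunE big_mkcond; apply: eq_bigr => v _.
  case: ifP => vF; last by rewrite big1.
  rewrite ffunE mulr_sumr big_mkcond; apply: eq_bigr => w _.
  by rewrite !inE negb_or andbC; case: ifP => _; rewrite // mulrA.
rewrite {1}xE exchange_big xE -sumrN; apply: eq_bigr => v _.
rewrite -sumrN; apply: eq_bigr => w _.
case: ifP => [/andP[/andP[wF vF] vw]|/negP nc]; last first.
  by case: ifP => [/andP[/andP[vF wF] wv]|]; rewrite ?oppr0 // in nc *; case: nc; rewrite wF vF eq_sym.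
by rewrite wF vF eq_sym vw /= setUCA sgn_swap // mulNr.
Qed.

(** Convexity puts every set between two members into X, so restricting after the first boundary
    loses no term of the second. *)
Lemma rbd_rbd X n c : convex X -> supported X n c -> rbd X (rbd X c) = 0.
Proof.
move=> cX sc; apply/ffunP => F; rewrite /rbd ffunE [RHS]ffunE.
case: ifP => // FX; rewrite -[RHS](_ : fbd (fbd c) F = 0); last by rewrite fbd_fbd ffunE.
rewrite !ffunE; apply: eq_bigr => v vF; rewrite !ffunE; case: ifP => // /negP vFX.
congr (_ * _); apply/esym/big1 => w wF; apply/eqP; apply: contra_notT vFX.
rewrite mulf_eq0 negb_or => /andP[_ /sc[KX _]].
by apply: cX FX KX _ _; apply: subsetU1.
Qed.

Lemma supportedB X n x y :
  supported X n x -> supported X n y -> supported X n (x - y).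
Proof.
move=> sx sy F; rewrite !ffunE; have [x0|xF _] := eqVneq (x F) 0; last exact: sx.
by rewrite x0 sub0r oppr_eq0 => /sy.
Qed.

Lemma is_cycleB X n x y : is_cycle X n x -> is_cycle X n y -> is_cycle X n (x - y).
Proof.
by move=> [sx zx] [sy zy]; split; [exact: supportedB | rewrite rbdB zx zy subr0].
Qed.

Lemma is_boundaryB X n x y :
  is_boundary X n x -> is_boundary X n y -> is_boundary X n (x - y).
Proof.
by move=> [a sa <-] [b sb <-]; exists (a - b); [exact: supportedB | rewrite rbdB].
Qed.

Lemma supported0 X n : supported X n 0.
Proof. by move=> F; rewrite ffunE eqxx. Qed.

Lemma rbd0 X : rbd X 0 = 0.
Proof. by rewrite -[X in rbd _ X](subrr 0) rbdB subrr. Qed.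

Lemma is_cycle0 X n : is_cycle X n 0.
Proof. by split; [exact: supported0 | exact: rbd0]. Qed.

Lemma is_boundary0 X n : is_boundary X n 0.
Proof. by exists 0; [exact: supported0 | exact: rbd0]. Qed.

Lemma fbd_neq0 c F : fbd c F != 0 -> exists2 v, v \notin F & c (v |: F) != 0.
Proof.
rewrite ffunE => nz; apply: contrapT => nex; case/negP: nz; apply/eqP.
apply: big1 => v vF; apply/eqP; rewrite mulf_eq0; apply/orP; right.
by apply/eqP; apply: contrapT => /eqP cv; apply: nex; exists v.
Qed.

Lemma supported_rbd X n c F : supported X n c ->
  rbd X c F != 0 -> F \in X /\ #|F|.+1 = n.
Proof.
move=> sc; rewrite ffunE; case: ifP => // FX.
by move=> /fbd_neq0[v vF /sc[_]]; rewrite cardsU1 vF.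
Qed.

(** * Cancelling sets in pairs *)

Definition toggled u Z := forall F, u \notin F -> (F \in Z) = (u |: F \in Z).

Definition cone u c : {ffun {set T} -> int} :=
  [ffun F : {set T} => if u \in F then sgn (F :\ u) u * c (F :\ u) else 0].

(** [cone u] is a contracting homotopy of the full simplex with its empty face. If F misses u, only
    the term v = u survives; if F contains u, the terms with v != u cancel by anticommutation. *)
Lemma fbd_cone u c (F : {set T}) : fbd (cone u c) F + cone u (fbd c) F = c F.
Proof.
rewrite !ffunE; case: ifP => [uF|/negbT uF]; last first.
  rewrite addr0 (bigD1 u) //= big1 ?addr0 => [|v /andP[vF vu]].
    by rewrite ffunE setU11 setU1K // mulrA sgn_sqr mul1r.
  by rewrite ffunE !inE eq_sym (negPf vu) (negPf uF) mulr0.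
set G := F :\ u; have uG : u \notin G by rewrite !inE eqxx.
have FE : F = u |: G by rewrite setD1K.
rewrite mulr_sumr [X in _ + X](bigD1 u) //= -FE mulrA sgn_sqr mul1r addrCA.
rewrite -[RHS]addr0; congr (_ + _).
have eqP v : (v \notin G) && (v != u) = (v \notin F).
  by rewrite !inE; case: eqVneq => [->|]; rewrite ?uF ?andbT ?andbF.
rewrite (eq_bigl _ _ eqP) -big_split /= big1 // => v vF.
rewrite ffunE !inE uF orbT.
have vu : v != u by apply: contraNneq vF => ->.
have vG : v \notin G by rewrite !inE (negPf vF) andbF.
have -> : (v |: F) :\ u = v |: G.
  by apply/setP => x; rewrite !inE; case: (eqVneq x v) => [->|]; rewrite ?vu.
rewrite !mulrA -mulrDl {1}FE.
suff -> : sgn (u |: G) v * sgn (v |: G) u = - (sgn G u * sgn G v).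
  by rewrite addNr mul0r.
have E : sgn G u * sgn (u |: G) v = - (sgn G v * sgn (v |: G) u) by rewrite sgn_swap.
(* A square [sgn G u * sgn G u] is inserted so that [sgn_swap] applies. *)
transitivity (sgn G u * (sgn G u * sgn (u |: G) v) * sgn (v |: G) u).
  by rewrite mulrA sgn_sqr mul1r.
by rewrite E mulrN mulNr -!mulrA sgn_sqr mulr1.
Qed.

(** The cone homotopy stays inside a toggled family: for F in Z containing u, also F minus u is in
    Z, where the boundary of c vanishes. So a cycle bounds its cone. *)
Lemma toggled_boundary Z u c : toggled u Z -> (forall F, c F != 0 -> F \in Z) ->
  rbd Z c = 0 -> rbd Z (cone u c) = c.
Proof.
move=> tZ sc c0; apply/ffunP => F; rewrite ffunE; case: ifP => [FZ|/negP FZ].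
  rewrite -[RHS](fbd_cone u) [cone u (fbd c) F]ffunE; case: ifP => [uF|]; last by rewrite addr0.
  have GZ : F :\ u \in Z by rewrite tZ ?setD1K // !inE eqxx.
  by have /ffunP/(_ (F :\ u)) := c0; rewrite !ffunE GZ => ->; rewrite mulr0 addr0.
by apply/esym/eqP; apply: contra_notT FZ => /sc.
Qed.

Lemma supported_cone Z u n c : toggled u Z ->
  (forall F, c F != 0 -> F \in Z /\ #|F|.+1 = n) -> supported Z n (cone u c).
Proof.
move=> tZ sc F; rewrite ffunE; case: ifP => [uF|]; last by rewrite eqxx.
rewrite mulf_eq0 negb_or => /andP[_ /sc[GZ <-]].
by rewrite -[F in F \in _](setD1K uF) -tZ ?inE ?eqxx // (cardsD1 u F) uF.
Qed.

Definition trivial_homology X n := trivial_quotient (is_cycle X n) (is_boundary X n).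
Definition cyclic_homology X n := cyclic_quotient (is_cycle X n) (is_boundary X n).

(** Weaker than an isomorphism: only vanishing and being infinite cyclic are compared, which is
    enough to recognise a point or a sphere. *)
Definition same_homology X Y := forall n,
  (trivial_homology X n <-> trivial_homology Y n) /\
  (cyclic_homology X n <-> cyclic_homology Y n).

(** Y spans a subcomplex of X, and the quotient spanned by the difference is contracted by [cone u];
    so the inclusion of Y is a quasi-isomorphism. *)
Lemma toggle_sub X Y u : convex X -> Y \subset X -> toggled u (X :\: Y) ->
  (forall F G, F \in X -> G \in Y -> F \subset G -> F \in Y) ->
  same_homology X Y.
Proof.
move=> cX /subsetP YX tZ dY n; set Z := X :\: Y in tZ.
have rE m c : supported Y m c -> rbd X c = rbd Y c.
  move=> sc; apply/ffunP => F; rewrite [LHS]ffunE [RHS]ffunE.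
  have [FY|FY] := boolP (F \in Y); first by rewrite YX.
  case: ifP => // FX; apply/eqP; apply: contraNT FY => /fbd_neq0[v vF /sc[GY _]].
  by apply: dY FX GY _; apply: subsetU1.
(* A chain whose boundary vanishes on Z is moved into Y by subtracting the boundary of the cone over
   its part in Z. *)
have push m c : supported X m c -> restrict Z (fbd c) = 0 ->
    exists2 e, supported X m.+1 e & supported Y m (c - rbd X e).
  move=> sc c0; pose cz := restrict Z c.
  have czZ F : cz F != 0 -> F \in Z /\ #|F|.+1 = m.+1.
    by rewrite ffunE; case: ifP => [FZ /sc[_ ->]|]; rewrite ?eqxx.
  have cz0 : rbd Z cz = 0.
    apply/ffunP => F; have /ffunP/(_ F) := c0; rewrite ffunE => E.
    rewrite -[RHS]E ffunE; case: ifP => // FZ; rewrite !ffunE; apply: eq_bigr => v vF.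
    rewrite ffunE; case: ifP => // GZ; congr (_ * _).
    apply/esym/eqP; apply: contraFT GZ => /sc[GX _]; rewrite inE GX andbT.
    move: FZ; rewrite inE => /andP[FY FX]; apply: contra FY => GY.
    by apply: dY FX GY _; apply: subsetU1.
  have eZ : supported Z m.+1 (cone u cz) by apply: supported_cone.
  have eX : supported X m.+1 (cone u cz).
    by move=> F /eZ[]; rewrite inE => /andP[_ ->].
  exists (cone u cz) => // F.
  rewrite !ffunE; case: (boolP (F \in Z)) => FZ.
    have := toggled_boundary tZ (fun F h => (czZ F h).1) cz0.
    move/ffunP/(_ F); rewrite !ffunE FZ; move: FZ; rewrite inE => /andP[_ ->] ->.
    by rewrite subrr eqxx.
  move=> nz; have : (c - rbd X (cone u cz)) F != 0 by rewrite !ffunE.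
  move=> nz'; have : F \in X /\ #|F| = m.
    apply: (supportedB sc _ nz') => K /(supported_rbd eX)[KX [<-]] //.
  by move=> [FX <-]; move: FZ; rewrite inE FX andbT negbK.
suff: (trivial_homology Y n <-> trivial_homology X n) /\
  (cyclic_homology Y n <-> cyclic_homology X n) by tauto.
apply: (@quasi_iso _ _ id) => //.
- exact: is_cycle0.
- exact: is_boundary0.
- exact: is_cycleB.
- exact: is_boundaryB.
- move=> c [sc zc]; split; last by rewrite (rE _ _ sc).
  by move=> F /sc[/YX].
- move=> c [sc zc]; split=> [[b sb eb]|[b sb eb]].
    by exists b; [move=> F /sb[/YX] | rewrite (rE _ _ sb)].
  have [|e se sbe] := push _ _ sb.
    apply/ffunP => F; rewrite !ffunE; case: ifP => // /setDP[FX FY].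
    have /ffunP/(_ F) := eb; rewrite [LHS]ffunE FX ffunE => ->.
    by apply/eqP; apply: contraNT FY => /sc[].
  exists (b - rbd X e) => //; rewrite -(rE _ _ sbe) rbdB eb.
  by rewrite (rbd_rbd cX se) subr0.
- move=> c [sc zc]; have [|e se sce] := push _ _ sc.
    apply/ffunP => F; rewrite [LHS]ffunE; case: ifP => [/setDP[FX _]|]; last by rewrite ffunE.
    by have /ffunP/(_ F) := zc; rewrite ffunE FX.
  exists (c - rbd X e); last by exists e => //; rewrite opprB addrC subrK.
  by split=> //; rewrite -(rE _ _ sce) rbdB zc (rbd_rbd cX se) subr0.
Qed.

(** Dual to [toggle_sub]: here the difference spans an acyclic subcomplex, Y is the quotient, and
    restriction to Y is the quasi-isomorphism. *)
Lemma toggle_quotient X Y u : convex X -> Y \subset X -> toggled u (X :\: Y) ->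
  (forall F G, F \in Y -> G \in X -> F \subset G -> G \in Y) ->
  same_homology X Y.
Proof.
move=> cX /subsetP YX tZ uY n; set Z := X :\: Y in tZ.
have rE c F : (forall K : {set T}, c K != 0 -> K \in X) -> F \in Y ->
    rbd X c F = rbd Y (restrict Y c) F.
  move=> sc FY; rewrite !ffunE FY YX //; apply: eq_bigr => v _; rewrite ffunE.
  case: ifP => // GY; congr (_ * _); apply/eqP; apply: contraFT GY => /sc GX.
  by apply: uY FY GX _; apply: subsetU1.
have restrict_id m c : supported Y m c -> restrict Y c = c.
  move=> sc; apply/ffunP => F; rewrite ffunE; case: ifP => // FY.
  by apply/esym/eqP; apply: contraFT FY => /sc[].
have suppX m c : supported Y m c -> supported X m c by move=> sc F /sc[/YX].
have rZ c : (forall K : {set T}, c K != 0 -> K \in Z) -> rbd X c = rbd Z c.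
  move=> sc; apply/ffunP => F; rewrite [LHS]ffunE [RHS]ffunE inE.
  have [FY|//] := boolP (F \in Y); case: ifP => // FX; apply/eqP.
  apply: contraTT FY => /fbd_neq0[v vF /sc /setDP[GX]]; apply: contra => FY.
  by apply: uY FY GX _; apply: subsetU1.
have fill m (d : {ffun {set T} -> int}) : (forall F, d F != 0 -> F \in Z /\ #|F|.+1 = m) -> rbd X d = 0 ->
    supported Z m (cone u d) /\ rbd X (cone u d) = d.
  move=> sw w0; have sw1 F : d F != 0 -> F \in Z by case/sw.
  have se := supported_cone tZ sw; split=> //.
  by rewrite (rZ _ (fun F h => (se F h).1)) (toggled_boundary tZ) // -rZ.
have suppXZ m c : supported Z m c -> supported X m c by move=> sc F /sc[/setDP[]].
apply: (@quasi_iso _ _ (restrict Y)).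
- exact: restrictB.
- exact: is_cycle0.
- exact: is_boundary0.
- exact: is_cycleB.
- exact: is_boundaryB.
- move=> c [sc zc]; split.
    by move=> F; rewrite ffunE; case: ifP => // FY /sc[].
  apply/ffunP => F; have [FY|/negPf FY] := boolP (F \in Y); last by rewrite !ffunE FY.
  by rewrite -rE ?zc ?ffunE // => K /sc[].
- move=> c [sc zc]; split=> [[b sb eb]|[b sb eb]].
    exists (restrict Y b); first by move=> F; rewrite ffunE; case: ifP => // FY /sb[].
    apply/ffunP => F; have [FY|/negPf FY] := boolP (F \in Y); last by rewrite !ffunE FY.
    by rewrite -rE // ?eb ?ffunE ?FY // => K /sb[].
  have sbX := suppX _ _ sb.
  have [||se ee] := fill n.+1 (c - rbd X b).
  - move=> F; have [FY|FY] := boolP (F \in Y).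
      have /ffunP/(_ F) := eb; rewrite [RHS]ffunE FY -{1}(restrict_id _ _ sb) -rE //; last by move=> K /sbX[].
      by move=> E; rewrite !ffunE in E *; rewrite E subrr eqxx.
    have sr : supported X n (rbd X b) by move=> K /(supported_rbd sbX)[? [->]].
    by move=> /(supportedB sc sr)[FX ->]; rewrite inE FY FX.
  - by rewrite rbdB zc (rbd_rbd cX sbX) subr0.
  exists (b + cone u (c - rbd X b)).
    by rewrite -[cone _ _]opprK; apply: supportedB => // F; rewrite ffunE oppr_eq0 => /(suppXZ _ _ se).
  rewrite -[cone _ _]opprK rbdB -[- cone _ _]sub0r rbdB rbd0 ee sub0r opprK.
  by rewrite addrC subrK.
(* The boundary in X of a cycle of Y lies in Z; subtracting a filling of it gives a cycle of X with
   the same restriction. *)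
- move=> c' [sc' zc']; have sX := suppX _ _ sc'.
  have [||se ee] := fill n (rbd X c').
  - move=> F nz; have [FX <-] := supported_rbd sX nz; rewrite inE FX andbT.
    split=> //; apply: contraNN nz => FY.
    by rewrite rE ?(restrict_id _ _ sc') ?zc' ?ffunE // => K /sX[].
  - exact: rbd_rbd cX sX.
  exists (c' - cone u (rbd X c')).
    split; first by apply: supportedB => //; apply: suppXZ.
    by rewrite rbdB ee subrr.
  rewrite restrictB (restrict_id _ _ sc') opprB addrC subrK.
  have -> : restrict Y (cone u (rbd X c')) = 0; last exact: is_boundary0.
  apply/ffunP => F; rewrite ffunE [RHS]ffunE; case: ifP => // FY.
  by apply/eqP; apply: contraTT FY => /se[/setDP[]].
Qed.

Lemma homology_set0 n : trivial_homology set0 n.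
Proof.
move=> c [sc _]; suff -> : c = 0 by apply: is_boundary0.
apply/ffunP => F; rewrite [RHS]ffunE; apply/eqP; apply: contraT => /sc[].
by rewrite inE.
Qed.

Lemma rbd_set1 (F : {set T}) n c : supported [set F] n c -> rbd [set F] c = 0.
Proof.
move=> sc; apply/ffunP => G; rewrite [RHS]ffunE; apply/eqP; apply: contraT.
rewrite ffunE; case: ifP => // /set1P -> /fbd_neq0[v vF /sc[]].
by rewrite inE => /eqP E; rewrite -E setU11 in vF.
Qed.

Lemma homology_set1 (F : {set T}) n : n != #|F| -> trivial_homology [set F] n.
Proof.
move=> nF c [sc _]; suff -> : c = 0 by apply: is_boundary0.
apply/ffunP => G; rewrite [RHS]ffunE; apply/eqP; apply: contraT => /sc[].
by move/set1P => -> E; rewrite E eqxx in nF.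
Qed.

Lemma homology_set1_card (F : {set T}) : cyclic_homology [set F] #|F|.
Proof.
pose z : {ffun {set T} -> int} := [ffun G => (G == F)%:R].
have sz : supported [set F] #|F| z.
  move=> G; have [->|/negPf GF] := eqVneq G F; rewrite ffunE ?GF ?inE ?eqxx //.
exists z; split; first by split=> //; exact: rbd_set1 sz.
  move=> c [sc _]; exists (c F); suff -> : c - z *~ c F = 0 by apply: is_boundary0.
  apply/ffunP => G; have [->|GF] := eqVneq G F.
    by rewrite !ffunE ffunMzE ffunE eqxx intz subrr.
  have c0 : c G = 0 by apply/eqP; apply: contraNT GF => /sc[/set1P->].
  by rewrite !ffunE ffunMzE ffunE c0 (negPf GF) mul0rz subrr.
move=> k [b sb]; rewrite (rbd_set1 sb) => /ffunP/(_ F).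
by rewrite ffunMzE !ffunE eqxx intz => <-.
Qed.

(* Exactness of H(Y) -> H(X) -> H(X :\: Y) for a subcomplex Y of X. *)
Lemma trivial_homology_ext X Y n : convex X -> Y \subset X ->
    (forall F G, F \in X -> G \in Y -> F \subset G -> F \in Y) ->
  trivial_homology Y n -> trivial_homology (X :\: Y) n -> trivial_homology X n.
Proof.
move=> cX /subsetP YX dY tY tZ c [sc zc]; set Z := X :\: Y in tZ.
have rZ m b : supported X m b -> rbd Z (restrict Z b) = restrict Z (rbd X b).
  move=> sb; apply/ffunP => F; rewrite !ffunE.
  case: ifP => // /setDP[FX FY]; rewrite FX; apply: eq_bigr => v _; rewrite ffunE.
  case: ifP => // GZ; congr (_ * _); apply/esym/eqP; apply: contraFT GZ => /sb[GX _].
  rewrite inE GX andbT; apply: contra FY => GY.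
  by apply: dY FX GY _; apply: subsetU1.
have [|b sb eb] := tZ (restrict Z c).
  split; first by move=> F; rewrite ffunE; case: ifP => // FZ /sc[].
  by rewrite (rZ _ _ sc) zc; apply/ffunP => F; rewrite !ffunE if_same.
have sbX : supported X n.+1 b by move=> F /sb[/setDP[]].
have se : supported Y n (c - rbd X b).
  have sr : supported X n (rbd X b) by move=> K /(supported_rbd sbX)[? [->]].
  move=> F nz; have [FX Fn] := supportedB sc sr nz; split=> //.
  apply: contraTT nz => FY; rewrite negbK.
  have /ffunP/(_ F) := eb; rewrite !ffunE !inE FX FY /= => ->.
  by rewrite subrr.
have [|a sa ea] := tY (c - rbd X b).
  split=> //; have -> : rbd Y (c - rbd X b) = rbd X (c - rbd X b).
    apply/ffunP => F; rewrite [LHS]ffunE [RHS]ffunE.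
    have [FY|FY] := boolP (F \in Y); first by rewrite YX.
    case: ifP => // FX; apply/esym/eqP; apply: contraNT FY => /fbd_neq0[v vF /se[GY _]].
    by apply: dY FX GY _; apply: subsetU1.
  by rewrite rbdB zc (rbd_rbd cX sbX) subrr.
have saX : supported X n.+1 a by move=> F /sa[/YX].
exists (a + b).
  by rewrite -[b]opprK; apply: supportedB => // F; rewrite ffunE oppr_eq0 => /sbX.
rewrite -[b]opprK rbdB -[- b]sub0r rbdB rbd0 sub0r opprK.
suff -> : rbd X a = rbd Y a by rewrite ea subrK.
apply/ffunP => F; rewrite [LHS]ffunE [RHS]ffunE.
have [FY|FY] := boolP (F \in Y); first by rewrite YX.
case: ifP => // FX; apply/eqP; apply: contraNT FY => /fbd_neq0[v vF /sa[GY _]].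
by apply: dY FX GY _; apply: subsetU1.
Qed.

End Boundary.

Local Close Scope ring_scope.

(** * Families of independent sets *)

Lemma same_homology_sym (T : finType) (r : T -> nat) X Y :
  same_homology r X Y -> same_homology r Y X.
Proof. by move=> h n; have [? ?] := h n; split; apply: iff_sym. Qed.

Lemma same_homology_trans (T : finType) (r : T -> nat) X Y Z :
  same_homology r X Y -> same_homology r Y Z -> same_homology r X Z.
Proof.
move=> h k n; have [? ?] := h n; have [? ?] := k n.
by split; apply: iff_trans; eassumption.
Qed.

Section Families.
Variables (T : finType) (r : T -> nat).
Hypothesis r_inj : injective r.
Implicit Types (A C U : {set T}) (P R : pred {set T}) (g : rel T) (u v w : T).

(* Families are described by the complements of their members: the boundary
   deletes elements, hence enlarges complements, so that the complex of the
   complements of the independent sets of a graph computes the cohomology of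
   the independence complex. *)
Definition cofamily P : {set {set T}} := [set Q | P (~: Q)].

Definition between_closed P := forall U1 U2 U3 : {set T},
  P U1 -> P U3 -> U1 \subset U2 -> U2 \subset U3 -> P U2.

Lemma cofamily_convex P : between_closed P -> convex (cofamily P).
Proof.
move=> cP F G K; rewrite !inE => PF PK FG GK.
by apply: cP PK PF _ _; rewrite setCS.
Qed.

(** Complementation reverses inclusions: a subfamily closed under smaller sets gives a quotient
    complex, one closed under larger sets a subcomplex. The sets of P outside R are paired by
    toggling u. *)
Lemma cofamily_toggle P R u : between_closed P -> (forall U, R U -> P U) ->
    (forall U, u \notin U -> P U -> ~~ R U -> P (u |: U) && ~~ R (u |: U)) ->
    (forall U, u \notin U -> P (u |: U) -> ~~ R (u |: U) -> P U && ~~ R U) ->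
    (forall U U', R U -> P U' -> U' \subset U -> R U') \/
    (forall U U', R U -> P U' -> U \subset U' -> R U') ->
  same_homology r (cofamily P) (cofamily R).
Proof.
move=> cP RP tu td dR.
have YX : cofamily R \subset cofamily P.
  by apply/subsetP => F; rewrite !inE => /RP.
have tZ : toggled u (cofamily P :\: cofamily R).
  move=> F uF; rewrite !inE.
  have FE : ~: F = u |: ~: (u |: F).
    by apply/setP => x; rewrite !inE; case: eqVneq => [->|].
  have uU : u \notin ~: (u |: F) by rewrite !inE eqxx.
  apply/andP/andP; rewrite FE => [[h1 h2]]; apply/andP; rewrite andbC.
    exact: td.
  exact: tu.
case: dR => dR.
  apply: (toggle_quotient r_inj (cofamily_convex cP) YX tZ) => F G.
  by rewrite !inE => RF PG FG; apply: dR RF PG _; rewrite setCS.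
apply: (toggle_sub r_inj (cofamily_convex cP) YX tZ) => F G.
by rewrite !inE => RF PG FG; apply: dR PG RF _; rewrite setCS.
Qed.

Lemma eq_cofamily P R : (forall U, P U = R U) -> cofamily P = cofamily R.
Proof. by move=> E; apply/setP => Q; rewrite !inE E. Qed.

(* C is the set of vertices that have been put into all independent sets, by
   passing to links or by cancelling the sets that avoid them. *)
Definition indep_family g C A : pred {set T} := fun U =>
  [&& C \subset U, U \subset C :|: A &
      [forall x in U :&: A, forall y in U :&: A, ~~ g x y]].

Lemma indep_familyP g C A U :
  reflect [/\ forall x, x \in C -> x \in U,
              forall x, x \in U -> x \in C \/ x \in A &
              forall x y, x \in U -> x \in A -> y \in U -> y \in A -> ~~ g x y]
          (indep_family g C A U).
Proof.
apply: (iffP and3P) => [[/subsetP CU /subsetP UC /forall_inP ind]|[CU UC ind]].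
  split=> // [x /UC|x y xU xA yU yA]; first by rewrite inE => /orP.
  by apply: (forall_inP (ind x _)); rewrite inE ?xU ?yU.
split; [exact/subsetP | by apply/subsetP => x /UC; rewrite inE => /orP |].
apply/forall_inP => x /setIP[xU xA]; apply/forall_inP => y /setIP[yU yA].
exact: ind.
Qed.

Lemma indep_family_closed g C A : between_closed (indep_family g C A).
Proof.
move=> U1 U2 U3 /indep_familyP[CU _ _] /indep_familyP[_ UC ind] /subsetP s12 /subsetP s23.
apply/indep_familyP; split=> [x /CU/s12|x /s23/UC|x y /s23 xU xA /s23 yU yA] //.
exact: ind.
Qed.

Section Graph.
Variables (g : rel T).
Hypotheses (gs : symmetric g) (gi : irreflexive g).

(** Toggling an isolated node pairs off the whole family. *)
Lemma indep_isolated C A u n : u \in A -> u \notin C ->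
  (forall y, y \in A -> ~~ g u y) ->
  trivial_homology r (cofamily (indep_family g C A)) n.
Proof.
move=> uA uC iso.
have h : same_homology r (cofamily (indep_family g C A)) (cofamily pred0).
  apply: (@cofamily_toggle _ _ u) => //; [exact: indep_family_closed | | | by left].
    move=> U uU /indep_familyP[CU UC ind] _; rewrite andbT; apply/indep_familyP; split.
    - by move=> x /CU xU; rewrite inE xU orbT.
    - by move=> x /setU1P[->|/UC //]; right.
    - move=> x y /setU1P[->|xU] xA /setU1P[->|yU] yA; rewrite ?gi //; first exact: iso.
        by rewrite gs; apply: iso.
      exact: ind.
  move=> U uU /indep_familyP[CU UC ind] _; rewrite andbT; apply/indep_familyP; split.
  - move=> x xC; have /setU1P[xu|//] := CU _ xC.
    by rewrite -xu xC in uC.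
  - by move=> x xU; apply: UC; rewrite inE xU orbT.
  - by move=> x y xU xA yU yA; apply: ind => //; rewrite inE ?xU ?yU orbT.
apply/(h n).1; have -> : cofamily pred0 = set0 by apply/setP => Q; rewrite !inE.
exact: homology_set0.
Qed.

(** A set containing w has no neighbour of w, hence none of u, so u can be toggled in it. The sets
    avoiding w remain. *)
Lemma indep_fold C A u w : u \in A -> w \in A -> u != w -> [disjoint C & A] ->
    (forall y, y \in A -> g u y -> g w y) ->
  same_homology r (cofamily (indep_family g C A)) (cofamily (indep_family g C (A :\ w))).
Proof.
move=> uA wA uw dCA dom.
have wC : w \notin C by apply: contraL wA => /(disjointFr dCA) ->.
have uC : u \notin C by apply: contraL uA => /(disjointFr dCA) ->.
have RE U : indep_family g C (A :\ w) U = indep_family g C A U && (w \notin U).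
  apply/idP/andP => [/indep_familyP[CU UC ind]|[/indep_familyP[CU UC ind] wU]].
    have wU : w \notin U by apply/negP => /UC; rewrite !inE eqxx (negPf wC) => -[].
    have ne x : x \in U -> x != w by move=> xU; apply: contraNneq wU => <-.
    split=> //; apply/indep_familyP; split=> // [x /UC|x y xU xA yU yA].
      by rewrite !inE => -[|/andP[]]; [left|right].
    by apply: ind => //; rewrite !inE ne.
  have ne x : x \in U -> x != w by move=> xU; apply: contraNneq wU => <-.
  apply/indep_familyP; split=> // [x xU|x y xU /setD1P[_ xA] yU /setD1P[_ yA]].
    by rewrite !inE (ne _ xU); apply: UC.
  exact: ind.
rewrite (eq_cofamily RE).
apply: (@cofamily_toggle _ _ u); first exact: indep_family_closed.
- by move=> U /andP[].
- move=> U uU PU; rewrite PU /= negbK => wU.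
  have /indep_familyP[CU UC ind] := PU.
  rewrite !inE wU orbT andbF andbT; apply/indep_familyP; split.
  - by move=> x /CU xU; rewrite inE xU orbT.
  - by move=> x /setU1P[->|/UC //]; right.
  - have gu y : y \in U -> y \in A -> ~~ g u y.
      by move=> yU yA; apply: contra (ind w y wU wA yU yA); apply: dom.
    move=> x y /setU1P[->|xU] xA /setU1P[->|yU] yA; rewrite ?gi //; first exact: gu.
      by rewrite gs; apply: gu.
    exact: ind.
- move=> U uU PU; rewrite PU /= negbK => /setU1P[wu|wU]; first by rewrite wu eqxx in uw.
  have /indep_familyP[CU UC ind] := PU.
  rewrite wU andbF andbT; apply/indep_familyP; split.
  - move=> x xC; have /setU1P[xu|//] := CU _ xC.
    by rewrite -xu xC in uC.
  - by move=> x xU; apply: UC; rewrite inE xU orbT.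
  - by move=> x y xU xA yU yA; apply: ind => //; rewrite inE ?xU ?yU orbT.
- left=> U U' /andP[_ wU] -> /subsetP s /=; by apply: contra wU => /s.
Qed.

(* If u is a leaf with neighbour v, the sets avoiding u cancel in pairs. *)
Lemma indep_leaf C A u v : u \in A -> v \in A -> [disjoint C & A] ->
    (forall y, y \in A -> g u y = (y == v)) -> (forall y, y \in A -> g v y = (y == u)) ->
  same_homology r (cofamily (indep_family g C A))
    (cofamily (indep_family g (u |: C) (A :\ u :\ v))).
Proof.
move=> uA vA dCA Nu Nv.
have vC : v \notin C by apply: contraL vA => /(disjointFr dCA) ->.
have uC : u \notin C by apply: contraL uA => /(disjointFr dCA) ->.
have guv : g u v by rewrite Nu.
have uv : u != v by apply: contraTneq guv => ->; rewrite gi.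
have RE U : indep_family g (u |: C) (A :\ u :\ v) U = indep_family g C A U && (u \in U).
  apply/idP/andP => [/indep_familyP[CU UC ind]|[/indep_familyP[CU UC ind] uU]].
    have vU : v \notin U.
      by apply/negP => /UC; rewrite !inE eqxx (negPf vC) eq_sym (negPf uv) => -[].
    have ne x : x \in U -> x != v by move=> xU; apply: contraNneq vU => <-.
    have uU : u \in U by apply: CU; rewrite setU11.
    split=> //; apply/indep_familyP; split.
    - by move=> x xC; apply: CU; rewrite inE xC orbT.
    - by move=> x /UC; rewrite !inE => -[/orP[/eqP->|]|/and3P[]]; [right|left|right].
    move=> x y xU xA yU yA.
    have [->|xu] := eqVneq x u; first by rewrite Nu // ne.
    have [->|yu] := eqVneq y u; first by rewrite gs Nu // ne.
    by apply: ind => //; rewrite !inE ne ?xu ?yu.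
  have vU : v \notin U by apply: contraL guv => vU; apply: ind.
  have ne x : x \in U -> x != v by move=> xU; apply: contraNneq vU => <-.
  apply/indep_familyP; split.
  - by move=> x /setU1P[->|/CU].
  - by move=> x xU; rewrite !inE (ne _ xU); case: eqVneq => //= _; [left | apply: UC].
  - by move=> x y xU /setD1P[_ /setD1P[_ xA]] yU /setD1P[_ /setD1P[_ yA]]; apply: ind.
rewrite (eq_cofamily RE).
apply: (@cofamily_toggle _ _ v); first exact: indep_family_closed.
- by move=> U /andP[].
- move=> U vU PU; rewrite PU /= => uU.
  have /indep_familyP[CU UC ind] := PU.
  have ne x : x \in U -> x != u by move=> xU; apply: contraNneq uU => <-.
  rewrite !inE (negPf uv) (negPf uU) andbF andbT; apply/indep_familyP; split.
  - by move=> x /CU xU; rewrite inE xU orbT.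
  - by move=> x /setU1P[->|/UC //]; right.
  - move=> x y /setU1P[->|xU] xA /setU1P[->|yU] yA; rewrite ?gi //.
    - by rewrite Nv // ne.
    - by rewrite gs Nv // ne.
    - exact: ind.
- move=> U vU PU; rewrite PU /= !inE negb_or => /andP[_ uU].
  have /indep_familyP[CU UC ind] := PU.
  rewrite (negPf uU) andbF andbT; apply/indep_familyP; split.
  - move=> x xC; have /setU1P[xv|//] := CU _ xC.
    by rewrite -xv xC in vC.
  - by move=> x xU; apply: UC; rewrite inE xU orbT.
  - by move=> x y xU xA yU yA; apply: ind => //; rewrite inE ?xU ?yU orbT.
- right=> U U' /andP[_ uU] -> /subsetP s /=; exact: s.
Qed.

(** The complements of the sets containing u are those missing u and form a subcomplex. It belongs
    to the link, where u joins C; the quotient belongs to the deletion. *)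
Lemma indep_delete_link C A u n : u \in A -> [disjoint C & A] ->
  trivial_homology r (cofamily (indep_family g C (A :\ u))) n ->
  trivial_homology r
    (cofamily (indep_family g (u |: C) [set x in A :\ u | ~~ g u x])) n ->
  trivial_homology r (cofamily (indep_family g C A)) n.
Proof.
move=> uA dCA.
have uC : u \notin C by apply: contraL uA => /(disjointFr dCA) ->.
have E1 : cofamily (indep_family g C (A :\ u)) =
    cofamily (indep_family g C A) :\: [set Q : {set T} | u \notin Q].
  apply/setP => Q; rewrite !inE negbK; set U := ~: Q.
  have -> : (u \in Q) = (u \notin U) by rewrite inE negbK.
  apply/idP/andP => [/indep_familyP[CU UC ind]|[uU /indep_familyP[CU UC ind]]].
    have uU : u \notin U by apply/negP => /UC; rewrite !inE eqxx (negPf uC) => -[].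
    have ne x : x \in U -> x != u by move=> xU; apply: contraNneq uU => <-.
    split=> //; apply/indep_familyP; split=> // [x /UC|x y xU xA yU yA].
      by rewrite !inE => -[|/andP[]]; [left|right].
    by apply: ind => //; rewrite in_setD1 ne.
  have ne x : x \in U -> x != u by move=> xU; apply: contraNneq uU => <-.
  apply/indep_familyP; split=> // [x xU|x y xU /setD1P[_ xA] yU /setD1P[_ yA]].
    by rewrite in_setD1 (ne _ xU); apply: UC.
  exact: ind.
have E2 : cofamily (indep_family g (u |: C) [set x in A :\ u | ~~ g u x]) =
    cofamily (indep_family g C A) :&: [set Q : {set T} | u \notin Q].
  apply/setP => Q; rewrite !inE; set U := ~: Q.
  have -> : (u \notin Q) = (u \in U) by rewrite inE.
  apply/idP/andP => [/indep_familyP[CU UC ind]|[/indep_familyP[CU UC ind] uU]].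
    have uU : u \in U by apply: CU; rewrite setU11.
    have gu x : x \in U -> x \in A -> ~~ g u x.
      move=> /UC[/setU1P[->|xC]|]; rewrite ?gi //; last by rewrite inE => /andP[].
      by rewrite (disjointFr dCA xC).
    split=> //; apply/indep_familyP; split.
    - by move=> x xC; apply: CU; rewrite inE xC orbT.
    - move=> x /UC[/setU1P[->|]|]; [by right|by left|].
      by rewrite !inE => /andP[/andP[]]; right.
    move=> x y xU xA yU yA.
    have [->|xu] := eqVneq x u; first exact: gu.
    have [->|yu] := eqVneq y u; first by rewrite gs; exact: gu.
    by apply: ind => //; rewrite inE in_setD1 ?xu ?yu ?xA ?yA gu.
  apply/indep_familyP; split.
  - by move=> x /setU1P[->|/CU].
  - move=> x xU; rewrite in_setU1 inE in_setD1; case: eqVneq => [->|xu]; first by left.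
    by have [xC|xA] := UC _ xU; [left|right; rewrite xA ind].
  - move=> x y xU; rewrite inE in_setD1 => /andP[/andP[_ xA] _] yU.
    rewrite inE in_setD1 => /andP[/andP[_ yA] _]; exact: ind.
rewrite E1 E2 => tD tL; set X := cofamily _ in tD tL *.
apply: (trivial_homology_ext r_inj _ (subsetIl X _) _ tL).
- exact/cofamily_convex/indep_family_closed.
- move=> F G FX; rewrite inE => /andP[_]; rewrite inE => uG /subsetP FG.
  by rewrite inE FX inE; apply: contra uG => /FG.
- suff <- : X :\: [set Q : {set T} | u \notin Q] = X :\: (X :&: [set Q : {set T} | u \notin Q]) by [].
  by rewrite setDIr setDv set0U.
Qed.

End Graph.

Lemma eq_indep_family g g' C A : [disjoint C & A] -> {in A &, g =2 g'} ->
  cofamily (indep_family g C A) = cofamily (indep_family g' C A).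
Proof.
move=> dCA E; apply: eq_cofamily => U.
apply/indep_familyP/indep_familyP => -[CU UC ind]; split=> // x y xU xA yU yA.
  by rewrite -E // ind.
by rewrite E // ind.
Qed.

(* The sets lost when the edges xy are added contain x and y, hence no
   neighbour of u, so that u can be added to or removed from them freely. *)
Lemma indep_add_edges g g' C A u : symmetric g -> irreflexive g ->
    u \in A -> [disjoint C & A] -> (forall x y, g x y -> g' x y) ->
    (forall x y, x \in A -> y \in A -> g' x y -> ~~ g x y ->
      [/\ x != u, y != u & forall z, z \in A -> g u z -> g z x || g z y]) ->
  same_homology r (cofamily (indep_family g C A)) (cofamily (indep_family g' C A)).
Proof.
move=> gs gi uA dCA gg' new.
have uC : u \notin C by apply: contraL uA => /(disjointFr dCA) ->.
have sub U : indep_family g' C A U -> indep_family g C A U.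
  move=> /indep_familyP[CU UC ind]; apply/indep_familyP; split=> // x y xU xA yU yA.
  by apply: contra (ind x y xU xA yU yA); apply: gg'.
have bad U : indep_family g C A U -> ~~ indep_family g' C A U ->
    exists x y, [/\ x \in U :&: A, y \in U :&: A, g' x y & ~~ g x y].
  move=> /indep_familyP[CU UC ind] nR; apply: contrapT => nex; case/negP: nR.
  apply/indep_familyP; split=> // x y xU xA yU yA; apply/negP => gxy; apply: nex.
  by exists x, y; split; rewrite ?inE ?xU ?yU // ind.
apply: (@cofamily_toggle _ _ u); first exact: indep_family_closed.
- exact: sub.
- move=> U uU PU nR; have [x [y [/setIP[xU xA] /setIP[yU yA] gxy ngxy]]] := bad _ PU nR.
  have [xu yu nb] := new _ _ xA yA gxy ngxy.
  have /indep_familyP[CU UC ind] := PU.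
  apply/andP; split; last first.
    apply: contraL gxy => /indep_familyP[_ _]; apply => //; by rewrite inE ?xU ?yU orbT.
  have gu z : z \in U -> z \in A -> ~~ g u z.
    move=> zU zA; apply/negP => /(nb _ zA)/orP[]; apply/negP; exact: ind.
  apply/indep_familyP; split.
  - by move=> z /CU zU; rewrite inE zU orbT.
  - by move=> z /setU1P[->|/UC //]; right.
  - move=> z t /setU1P[->|zU] zA /setU1P[->|tU] tA; rewrite ?gi //; first exact: gu.
      by rewrite gs; apply: gu.
    exact: ind.
- move=> U uU PU nR; have [x [y [/setIP[xU xA] /setIP[yU yA] gxy ngxy]]] := bad _ PU nR.
  have [xu yu nb] := new _ _ xA yA gxy ngxy.
  have /indep_familyP[CU UC ind] := PU.
  apply/andP; split.
    apply/indep_familyP; split.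
    - move=> z zC; have /setU1P[zu|//] := CU _ zC.
      by rewrite -zu zC in uC.
    - by move=> z zU; apply: UC; rewrite inE zU orbT.
    - by move=> z t zU zA tU tA; apply: ind => //; rewrite inE ?zU ?tU orbT.
  apply: contraL gxy => /indep_familyP[_ _]; apply => //.
    by move: xU; rewrite !inE (negPf xu).
  by move: yU; rewrite !inE (negPf yu).
- left=> U U' RU PU' /subsetP s.
  have /indep_familyP[CU UC ind] := RU; have /indep_familyP[CU' UC' ind'] := PU'.
  by apply/indep_familyP; split=> // x y /s xU xA /s yU yA; apply: ind.
Qed.

(** The graph with b identified with a, kept on the same type: a receives the neighbours of b, and b
    is dropped by removing it from A. *)
Definition merge_edges g a b : rel T := fun x y =>
  [|| g x y, (x == a) && g b y | (y == a) && g b x].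

(* The edges from a to the neighbours x != q of b can be added, since q then
   has no neighbour compatible with a and x; the edges bx can be removed, since
   p has none compatible with b and x. This leaves b as a leaf at q, so that p
   is redundant and b - q becomes a component. *)
Lemma indep_contract g C A a p q b : symmetric g -> irreflexive g ->
    a \in A -> p \in A -> q \in A -> b \in A -> [disjoint C & A] ->
    a != q -> p != b -> a != b -> ~~ g a b ->
    (forall y, y \in A -> g p y = (y == a) || (y == q)) ->
    (forall y, y \in A -> g q y = (y == p) || (y == b)) ->
  same_homology r (cofamily (indep_family g C A))
    (cofamily (indep_family (merge_edges g a b) (q |: C) (A :\ p :\ q :\ b))).
Proof.
move=> gs gi aA pA qA bA dCA aq pb ab ngab Np Nq.
have gpa : g p a by rewrite Np // eqxx.
have gpq : g p q by rewrite Np // eqxx orbT.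
have gqb : g q b by rewrite Nq // eqxx orbT.
have pa : p != a by apply: contraTneq gpa => ->; rewrite gi.
have pq : p != q by apply: contraTneq gpq => ->; rewrite gi.
have qb : q != b by apply: contraTneq gqb => ->; rewrite gi.
pose g1 : rel T := fun x y =>
  [|| g x y, [&& x == a, g b y & y != q] | [&& y == a, g b x & x != q]].
pose g2 : rel T := fun x y => [&& g1 x y, (x == b) ==> (y == q) & (y == b) ==> (x == q)].
have ngba : ~~ g b a by rewrite gs.
have g1s : symmetric g1.
  by move=> x y; rewrite /g1 gs [X in _ || X]orbC.
have g2s : symmetric g2 by move=> x y; rewrite /g2 g1s [X in _ && X]andbC.
have g1i : irreflexive g1.
  by move=> x; rewrite /g1 gi orbb; case: eqVneq => //= ->; rewrite (negPf ngba).
have g2i : irreflexive g2 by move=> x; rewrite /g2 g1i.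
have g21 x y : g2 x y -> g1 x y by case/andP.
have s1 : same_homology r (cofamily (indep_family g C A)) (cofamily (indep_family g1 C A)).
  apply: (@indep_add_edges _ _ _ _ q) => // [x y gxy|x y xA yA]; first by rewrite /g1 gxy.
  rewrite /g1 => /or3P[->//|/and3P[/eqP-> gby yq]|/and3P[/eqP-> gbx xq]] _; split=> // z zA.
    by rewrite Nq // => /orP[]/eqP->; rewrite ?gpa ?gby ?orbT.
  by rewrite Nq // => /orP[]/eqP->; rewrite ?gpa ?gbx ?orbT.
have gbp : g b p = false.
  by rewrite gs Np // [b == a]eq_sym (negPf ab) [b == q]eq_sym (negPf qb).
(* [indep_add_edges] only adds edges, so the removal of edges at b is proved from [g2] to [g1] and
   used in reverse. *)
have s2 : same_homology r (cofamily (indep_family g2 C A)) (cofamily (indep_family g1 C A)).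
  have key y z : y \in A -> z \in A -> g1 b y -> y != q -> g2 p z -> g2 z b || g2 z y.
    move=> yA zA gby yq /g21; have {gby} gby : g b y.
      move: gby; rewrite /g1 eq_sym (negPf ab) /= gi /= andbF orbF => //.
    have yb : y != b by apply: contraTneq gby => ->; rewrite gi.
    have -> : g1 p z = g p z by rewrite /g1 (negPf pa) gbp /= andbF !orbF.
    rewrite Np // => /orP[]/eqP->; apply/orP; [right|left].
      by rewrite /g2 /g1 eqxx gby yq (negPf ab) (negPf yb) !orbT.
    by rewrite /g2 /g1 gqb !eqxx (negPf qb).
  apply: (@indep_add_edges _ _ _ _ p) => // x y xA yA gxy.
  have np z : z != q -> g1 b z -> z != p.
    move=> zq; apply: contraTneq => ->; by rewrite /g1 gbp eq_sym (negPf ab) (negPf pa).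
  rewrite /g2 gxy /= negb_and !negb_imply => /orP[]/andP[/eqP E nq]; rewrite {}E in gxy *.
    by split=> [||z zA]; [rewrite eq_sym | exact: np | apply: key].
  rewrite g1s in gxy.
  by split=> [||z zA]; [exact: np | rewrite eq_sym | rewrite orbC; apply: key].
have N2b y : y \in A -> g2 b y = (y == q).
  move=> yA; rewrite /g2 eqxx /=; apply/and3P/eqP => [[_ /eqP->]//|->].
  by rewrite /g1 gs gqb eqxx (negPf qb).
have s3 := @indep_fold g2 g2s g2i C A b p bA pA.
have {s3} s3 : same_homology r (cofamily (indep_family g2 C A))
    (cofamily (indep_family g2 C (A :\ p))).
  apply: s3; rewrite // 1?eq_sym // => y yA; rewrite N2b // => /eqP->.
  by rewrite /g2 /g1 gpq (negPf pb) (negPf qb).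
have qAp : q \in A :\ p by rewrite !inE eq_sym pq.
have bAp : b \in A :\ p by rewrite !inE eq_sym pb.
have dAp : [disjoint C & A :\ p] by apply: disjointWr dCA; apply: subsetDl.
have s4 := @indep_leaf g2 g2s g2i C (A :\ p) q b qAp bAp dAp.
apply: (same_homology_trans s1); apply: (same_homology_trans (same_homology_sym s2)).
apply: (same_homology_trans s3).
suff <- : cofamily (indep_family g2 (q |: C) (A :\ p :\ q :\ b)) =
    cofamily (indep_family (merge_edges g a b) (q |: C) (A :\ p :\ q :\ b)).
  apply: s4 => y /setD1P[yp yA]; last exact: N2b.
  apply/idP/eqP => [|->]; last by rewrite g2s N2b.
  case/and3P; rewrite /g1 (eq_sym q a) (negPf aq) /= => /orP[|].
    by rewrite Nq // (negPf yp) => /eqP.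
  by rewrite eqxx !andbF.
apply: eq_indep_family.
  rewrite disjoints_subset; apply/subsetP => x /setU1P[->|xC].
    by rewrite !inE eqxx !andbF.
  by rewrite !inE (disjointFr dCA xC) !andbF.
move=> x y; rewrite !inE => /and4P[xb xq xp xA] /and4P[yb yq yp yA].
by rewrite /g2 /g1 /merge_edges (negPf xb) (negPf yb) xq yq !andbT.
Qed.

End Families.

(** * Graphs whose cycles have length 1 modulo 3 *)

Lemma mem_split (T : eqType) (x : T) s : x \in s -> exists s1 s2, s = s1 ++ x :: s2.
Proof. by case/splitPr => s1 s2; exists s1, s2. Qed.

(** 2a = (a + b) + (a + c) - (b + c) is 2 modulo 3, and 2 is invertible. *)
Lemma mod3_half a b c :
  (a + b) %% 3 = 2 -> (a + c) %% 3 = 2 -> (b + c) %% 3 = 2 -> a %% 3 = 1.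
Proof.
rewrite -(modnDm a b) -(modnDm a c) -(modnDm b c).
have := ltn_pmod c (isT : 0 < 3); have := ltn_pmod b (isT : 0 < 3).
have := ltn_pmod a (isT : 0 < 3).
by case: (a %% 3) (b %% 3) (c %% 3) => [|[|[|?]]] [|[|[|?]]] [|[|[|?]]].
Qed.

Lemma mod3_pred n : n.+1 %% 3 = 1 -> n %% 3 = 0.
Proof.
rewrite -addn1 -modnDml; have := ltn_pmod n (isT : 0 < 3).
by case: (n %% 3) => [|[|[|]]].
Qed.

Lemma mod3_pred2 n : n.+2 %% 3 = 1 -> n %% 3 = 2.
Proof.
rewrite -addn2 -modnDml; have := ltn_pmod n (isT : 0 < 3).
by case: (n %% 3) => [|[|[|]]].
Qed.

Section Cycles.
Variables (T : finType) (g : rel T) (A : {set T}).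
Hypotheses (gs : symmetric g) (gi : irreflexive g).

(** [cycle g [:: x; y]] holds for every edge xy, whence the lower bound on the length. *)
Definition cycles_mod3 := forall s : seq T,
  {subset s <= A} -> uniq s -> cycle g s -> 2 < size s -> size s %% 3 = 1.

Hypothesis cyc : cycles_mod3.

Lemma cycle_split x y s1 s2 : cycle g (x :: s1 ++ y :: s2) =
  path g x (rcons s1 y) && path g y (rcons s2 x).
Proof. by rewrite /= rcons_cat /= -cat_rcons cat_path last_rcons. Qed.

Lemma perm_split (x y : T) s1 s2 s3 :
  perm_eq (x :: s1 ++ y :: s2 ++ s3) (x :: y :: s1 ++ s2 ++ s3).
Proof. by rewrite perm_cons -[y :: _]cat1s perm_catCA. Qed.

(** The lists hold the inner vertices, so the cycle has two vertices more. At least one inner vertex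
    is required, as otherwise one edge is run through twice. *)
Lemma two_paths_mod3 x y s1 s2 :
  path g x (rcons s1 y) -> path g y (rcons s2 x) -> uniq (x :: y :: s1 ++ s2) ->
  {subset x :: y :: s1 ++ s2 <= A} -> 0 < size s1 + size s2 ->
  (size s1 + size s2) %% 3 = 2.
Proof.
move=> p1 p2 u sA sz.
have pe := perm_split x y s1 s2 [::]; rewrite !cats0 in pe.
have := @cyc (x :: s1 ++ y :: s2) _ _ _ _; rewrite cycle_split p1 p2 (perm_uniq pe).
rewrite /= size_cat /= addnS => h; apply/mod3_pred2.
by apply: h => //; move=> v; rewrite (perm_mem pe); apply: sA.
Qed.

Lemma rev_path_rcons x y s : path g x (rcons s y) -> path g y (rcons (rev s) x).
Proof.
move=> p; rewrite -rev_cons -[rcons s y]/(rcons s y) in p *.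
have := rev_path g x (rcons s y); rewrite last_rcons belast_rcons => ->.
by rewrite (eq_path (e' := g)) // => u v; rewrite gs.
Qed.

(* Any two of the three paths between x and y bound a cycle. *)
Lemma theta_mod3 x y s1 s2 s3 :
  path g x (rcons s1 y) -> path g y (rcons s2 x) -> path g x (rcons s3 y) ->
  uniq (x :: y :: s1 ++ s2 ++ s3) -> {subset x :: y :: s1 ++ s2 ++ s3 <= A} ->
  0 < size s1 + size s2 -> 0 < size s1 + size s3 -> 0 < size s2 + size s3 ->
  [/\ size s1 %% 3 = 1, size s2 %% 3 = 1 & size s3 %% 3 = 1].
Proof.
move=> p1 p2 p3 u sA h12 h13 h23.
have sub s : subseq s (s1 ++ s2 ++ s3) ->
    uniq (x :: y :: s) /\ {subset x :: y :: s <= A}.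
  move=> ss; have ss' : subseq (x :: y :: s) (x :: y :: s1 ++ s2 ++ s3).
    by rewrite /= !eqxx.
  by split; [exact: subseq_uniq ss' u | move=> v /(mem_subseq ss')/sA].
have [u12 A12] := sub (s1 ++ s2) (cat_subseq (subseq_refl _) (prefix_subseq _ _)).
have [u13 A13] := sub (s1 ++ s3) (cat_subseq (subseq_refl _) (suffix_subseq _ _)).
have [u23 A23] := sub (s2 ++ s3) (suffix_subseq _ _).
have r3 := rev_path_rcons p3; have r2 := rev_path_rcons p2.
have e12 := two_paths_mod3 p1 p2 u12 A12 h12.
have pm s s' : perm_eq (x :: y :: s ++ rev s') (x :: y :: s ++ s').
  by rewrite !perm_cons perm_cat2l perm_rev.
have e13 := two_paths_mod3 p1 r3; rewrite size_rev (perm_uniq (pm _ _)) in e13.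
have {}e13 := e13 u13 _ h13.
have {}e13 : (size s1 + size s3) %% 3 = 2.
  by apply: e13 => v; rewrite (perm_mem (pm _ _)); apply: A13.
have p23 : perm_eq (x :: y :: s3 ++ s2) (x :: y :: s2 ++ s3).
  by rewrite !perm_cons perm_catC.
have e23 := two_paths_mod3 p3 p2; rewrite (perm_uniq p23) addnC in e23.
have {}e23 : (size s2 + size s3) %% 3 = 2.
  by apply: e23 => // v; rewrite (perm_mem p23); apply: A23.
have e21 : (size s2 + size s1) %% 3 = 2 by rewrite addnC.
have e31 : (size s3 + size s1) %% 3 = 2 by rewrite addnC.
have e32 : (size s3 + size s2) %% 3 = 2 by rewrite addnC.
by split; [exact: mod3_half e12 e13 e23 | exact: mod3_half e21 e23 e13 |
  exact: mod3_half e31 e32 e12].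
Qed.

(** A chord would be the third path of a theta graph, with 0 inner vertices instead of 1 modulo
    3. *)
Lemma cycle_no_chord x y s1 s2 : cycle g (x :: s1 ++ y :: s2) ->
  uniq (x :: s1 ++ y :: s2) -> {subset x :: s1 ++ y :: s2 <= A} ->
  0 < size s1 -> 0 < size s2 -> ~~ g x y.
Proof.
rewrite cycle_split => /andP[p1 p2] u sA h1 h2; apply/negP => gxy.
have pe := perm_split x y s1 s2 [::]; rewrite cats0 in pe.
have p3 : path g x (rcons [::] y) by rewrite /= gxy.
have u' : uniq (x :: y :: s1 ++ s2 ++ [::]) by rewrite cats0 -(perm_uniq pe).
have sA' : {subset x :: y :: s1 ++ s2 ++ [::] <= A}.
  by move=> v; rewrite cats0 -(perm_mem pe); apply: sA.
by have [] := theta_mod3 p1 p2 p3 u' sA'; rewrite ?addn_gt0 ?h1 ?h2.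
Qed.

(** A walk in D shortens to a simple path off the cycle, the third path of a theta graph. *)
Lemma cycle_ear_mod3 x y s1 s2 (D : {set T}) dx dy :
    cycle g (x :: s1 ++ y :: s2) -> uniq (x :: s1 ++ y :: s2) ->
    {subset x :: s1 ++ y :: s2 <= A} -> 0 < size s1 + size s2 ->
    D \subset A -> {in D, forall v, v \notin x :: s1 ++ y :: s2} ->
    dx \in D -> g x dx -> g y dy ->
    connect [rel u v | [&& u \in D, v \in D & g u v]] dx dy ->
  size s1 %% 3 = 1.
Proof.
rewrite cycle_split => /andP[p1 p2] u sA h12 /subsetP DA dis dxD gx gy.
case/connectP => q pq dyE; move: gy; rewrite {}dyE.
case/shortenP: pq => p pp up _ gy.
have pD : {subset dx :: p <= D}.
  elim: p dx dxD {up gx gy} pp => [|v p IH] w wD /=; first by move=> _ ?; rewrite inE => /eqP->.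
  case/andP=> /and3P[_ vD _] /(IH _ vD) sub ?.
  by rewrite inE => /orP[/eqP->|/sub].
have pg : path g dx p by apply: sub_path pp => v w /and3P[].
have pe := perm_split x y s1 s2 (dx :: p).
have p3 : path g x (rcons (dx :: p) y) by rewrite /= gx rcons_path pg gs.
have E : x :: s1 ++ y :: s2 ++ dx :: p = (x :: s1 ++ y :: s2) ++ dx :: p.
  by rewrite /= -catA.
have u' : uniq (x :: y :: s1 ++ s2 ++ dx :: p).
  rewrite -(perm_uniq pe) E cat_uniq u up andbT; apply/hasPn => v /pD; exact: dis.
have sA' : {subset x :: y :: s1 ++ s2 ++ dx :: p <= A}.
  by move=> v; rewrite -(perm_mem pe) E mem_cat => /orP[/sA|/pD/DA].
by have [] := theta_mod3 p1 p2 p3 u' sA'; rewrite ?addn_gt0 ?orbT //= -addn_gt0.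
Qed.

(** The situation in which no fold is left and every node has degree at least 2. *)
Hypothesis nofold : forall u w, u \in A -> w \in A -> u != w ->
  ~ (forall y, y \in A -> g u y -> g w y).
Hypothesis mindeg : forall u v, u \in A -> exists w, [/\ w \in A, g u w & w != v].

(** The triangle a = b is not excluded here; the condition on cycles rules it out later. *)
Definition adjacent_degree2 := exists p q a b : T,
  [/\ [/\ p \in A, q \in A, a \in A & b \in A], a != q, p != b,
      forall y, y \in A -> g p y = (y == a) || (y == q) &
      forall y, y \in A -> g q y = (y == p) || (y == b)].

(** * Longest paths whose first vertex closes a cycle *)

Section Longest.

Variable L : nat.
Hypothesis maxL : forall x s, path g x s -> uniq (x :: s) ->
  {subset x :: s <= A} -> size (x :: s) <= L.

(* A longest path, whose first vertex is also adjacent to the vertex z. *)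
Definition lollipop d z t :=
  [/\ cycle g (z :: d), path g z t, uniq (z :: d ++ t), {subset z :: d ++ t <= A}
    & size (z :: d ++ t) = L].

(** Running through the cycle backwards makes the last vertex of d, too, the end of a longest
    path. *)
Lemma lollipop_rev d z t : lollipop d z t -> lollipop (rev d) z t.
Proof.
have pe : perm_eq (z :: rev d ++ t) (z :: d ++ t).
  by rewrite perm_cons perm_cat2r perm_rev.
case=> c p u sA sz; split=> //; rewrite ?(perm_uniq pe) ?(perm_size pe) //.
  rewrite -(rot_cycle 1) rot1_cons -rev_cons rev_cycle.
  by rewrite (eq_cycle (e' := g)) // => v w; rewrite gs.
by move=> v; rewrite (perm_mem pe); apply: sA.
Qed.

Lemma lollipop_path x d z t : lollipop (x :: d) z t ->
  [/\ g z x, path g x (d ++ z :: t), uniq (x :: d ++ z :: t),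
      {subset x :: d ++ z :: t <= A} & size (x :: d ++ z :: t) = L].
Proof.
have pe : perm_eq (z :: (x :: d) ++ t) (x :: d ++ z :: t).
  by apply/permPl; apply: (perm_catCA [:: z] (x :: d) t).
rewrite /lollipop (cycle_split z x [::] d) => -[/andP[/andP[gzx _] p] pt].
rewrite (perm_uniq pe) (perm_size pe) => u sA sz; split=> //.
- by rewrite -cat_rcons cat_path p last_rcons.
- by move=> v; rewrite -(perm_mem pe); apply: sA.
Qed.

Lemma lollipop_cycle d z t : lollipop d z t ->
  [/\ cycle g (rcons d z), uniq (rcons d z), {subset rcons d z <= A}
    & {in t, forall v, v \notin rcons d z}].
Proof.
have pe : perm_eq (z :: d ++ t) (rcons d z ++ t).
  by rewrite -cat_cons perm_cat2r perm_sym perm_rcons.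
case=> c _ u sA _; split.
- by rewrite -rot1_cons rot_cycle.
- by move: u; rewrite (perm_uniq pe) cat_uniq => /andP[].
- by move=> v vd; apply: sA; rewrite (perm_mem pe) mem_cat vd.
- move: u; rewrite (perm_uniq pe) cat_uniq => /and3P[_ /hasPn h _] v /h //.
Qed.

(** A further neighbour of x0 in d is a chord of the cycle; one in t closes a larger cycle with
    chord x0z; one off the path makes the path longer. *)
Lemma lollipop_end x0 x1 d z t : lollipop [:: x0, x1 & d] z t ->
  forall v, v \in A -> g x0 v = (v == x1) || (v == z).
Proof.
move=> lp v vA; have [gz p u sA sz] := lollipop_path lp.
have [cc cu cA _] := lollipop_cycle lp.
apply/idP/orP => [gv|[]/eqP->]; last first.
- by rewrite gs.
- by move: p => /= /andP[].
apply/orP; apply: contraT; rewrite negb_or => /andP[v1 vz].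
have [vd|vd] := boolP (v \in d).
  case/splitPr: vd cc cu cA => e1 e2.
  have -> : rcons [:: x0, x1 & e1 ++ v :: e2] z = x0 :: (x1 :: e1) ++ v :: rcons e2 z.
    by rewrite /= rcons_cat.
  move=> cc cu cA; by have := cycle_no_chord cc cu cA isT; rewrite size_rcons gv => /(_ isT).
have [vt|vt] := boolP (v \in t).
  case/splitPr: vt p u sA {lp sz} => t1 t2.
  have -> : (x1 :: d) ++ z :: t1 ++ v :: t2 = ((x1 :: d) ++ z :: rcons t1 v) ++ t2.
    by rewrite -catA /= cat_rcons.
  rewrite cat_path => /andP[p _].
  set c := (x1 :: d) ++ z :: rcons t1 v; rewrite -(cat_cons x0 c t2) cat_uniq => /and3P[u _ _] sA.
  have /negP[] : ~~ g x0 z; last by rewrite gs.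
  apply: (@cycle_no_chord x0 z (x1 :: d) (rcons t1 v)); rewrite ?size_rcons //.
  - by rewrite /cycle rcons_path last_cat /= last_rcons [g v x0]gs gv andbT.
  - by move=> w wi; apply: sA; rewrite mem_cat wi.
have vx : v != x0 by apply: contraTneq gv => ->; rewrite gi.
have vn : v \notin x0 :: (x1 :: d) ++ z :: t.
  by rewrite !inE mem_cat inE !negb_or vx v1 vd vz vt.
have p' : path g v (x0 :: (x1 :: d) ++ z :: t) by apply/andP; split; [rewrite gs|].
have u' : uniq (v :: x0 :: (x1 :: d) ++ z :: t) by apply/andP; split.
have sA' : {subset v :: x0 :: (x1 :: d) ++ z :: t <= A}.
  by move=> w; rewrite inE => /orP[/eqP->|/sA].
have := maxL p' u' sA'.
have -> : size (v :: x0 :: (x1 :: d) ++ z :: t) = L.+1 by rewrite -sz.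
by rewrite ltnn.
Qed.

(** If x1 has degree 2, then x0 and x1 are as wanted. Otherwise a third neighbour y of x1 is not on
    the cycle, which has no chords. If y is not on the tail either, replacing x0 by y gives another
    longest path, which contains a second neighbour v of y: a v on the tail gives the escape, a v in
    [x2 :: d] a shorter lollipop. Escapes are led to the first tail vertex so that two of them can
    be joined off the cycle. *)
Lemma lollipop_escape x0 x1 x2 d z t :
    lollipop [:: x0, x1, x2 & d] z t ->
    (forall d' z' t', lollipop d' z' t' -> 1 < size d' < (size d).+3 ->
       adjacent_degree2) ->
    adjacent_degree2 \/
    exists y t0 t', let D := [set v in A | v \notin z :: [:: x0, x1, x2 & d]] in
      [/\ t = t0 :: t', y \in D, g x1 y &
        connect [rel u v | [&& u \in D, v \in D & g u v]] y t0].
Proof.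
move=> lp IH; have [gz p u sA sz] := lollipop_path lp.
have [cc cu cA ct] := lollipop_cycle lp.
have N0 := lollipop_end lp.
have x0A : x0 \in A by apply: sA; rewrite inE eqxx.
have x1A : x1 \in A by apply: sA; rewrite !inE eqxx orbT.
have x2A : x2 \in A by apply: sA; rewrite !inE eqxx !orbT.
have zA : z \in A by apply: sA; rewrite !(inE, mem_cat) eqxx !orbT.
have g01 : g x0 x1 by rewrite N0 // eqxx.
have g12 : g x1 x2 by case/and3P: p.
have [x02 zx1 zx2] : [/\ x0 != x2, x1 != z & x2 != z].
  move: (cu); rewrite /= !(inE, mem_rcons) !negb_or.
  by case/and4P=> /and4P[_ -> _ _] /and3P[_ -> _] /andP[-> _].
have [[y [yA gy y0 y2]]|nex] := pselect (exists y, [/\ y \in A, g x1 y, y != x0 & y != x2]);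
  last first.
  left; exists x0, x1, z, x2; split=> //.
  - by rewrite eq_sym.
  - by move=> y yA; rewrite N0 // orbC.
  - move=> y yA; apply/idP/orP => [gy|[]/eqP->] //; last by rewrite gs.
    apply/orP; apply: contraT; rewrite negb_or => /andP[y0 y2].
    by case: nex; exists y.
set D := [set v in A | v \notin z :: [:: x0, x1, x2 & d]].
have inD v : v \in A -> v \notin rcons [:: x0, x1, x2 & d] z -> v \in D.
  by move=> vA; rewrite mem_rcons => h; rewrite inE vA.
have tD v : v \in t -> v \in D.
  by move=> vt; apply: inD; [apply: sA; rewrite -cat_rcons inE mem_cat vt !orbT | exact: ct].
have escape v w : v \in D -> w \in t -> g x1 v -> v = w \/ g v w ->
    exists y t0 t', [/\ t = t0 :: t', y \in D, g x1 y &
        connect [rel u v | [&& u \in D, v \in D & g u v]] y t0].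
  move=> vD wt g1v vw; have [_ pt _ _ _] := lp.
  case: t tD wt pt {lp p u sA sz ct} => // t0 t' tD wt /= /andP[_ pt].
  exists v, t0, t'; split=> //.
  have cs : connect_sym [rel u v | [&& u \in D, v \in D & g u v]].
    by apply: sym_connect_sym => a b; rewrite /= gs andbCA.
  have ct : connect [rel u v | [&& u \in D, v \in D & g u v]] w t0.
    rewrite cs; apply: (path_connect (p := t')) => //.
    elim: t' t0 tD pt {wt} => // t1 t' IHt t0 tD /= /andP[-> pt].
    rewrite !tD ?inE ?eqxx ?orbT //=; apply: IHt => // a at'.
    by apply: tD; rewrite inE at' orbT.
  case: vw => [->//|gvw]; apply: connect_trans ct; apply: connect1.
  by rewrite /= vD tD.
have [yD|yD] := boolP (y \in D); last first.
  have : y \in rcons [:: x0, x1, x2 & d] z by apply: contraR yD; apply: inD.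
  rewrite mem_rcons !inE (negPf y0) (negPf y2) /=.
  have [E|y1] := eqVneq y x1; first by rewrite E gi in gy.
  move=> yzd; exfalso.
  have [e1 [e2 E]] : exists e1 e2, rcons d z = e1 ++ y :: e2.
    have : y \in rcons d z by rewrite mem_rcons inE.
    by move/mem_split.
  have Er : rot 1 (rcons [:: x0, x1, x2 & d] z) = x1 :: (x2 :: e1) ++ y :: rcons e2 x0.
    by rewrite /= rot1_cons /= E rcons_cat.
  have := @cycle_no_chord x1 y (x2 :: e1) (rcons e2 x0).
  rewrite -Er rot_cycle rot_uniq size_rcons gy => /(_ cc cu) h.
  suff : ~~ true by [].
  apply: h => //.
  by move=> v; rewrite mem_rot; apply: cA.
have [yt|yt] := boolP (y \in t).
  right; have [y' [t0 [t' [*]]]] := escape y y yD yt gy (or_introl erefl).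
  by exists y', t0, t'; split.
set P := (x2 :: d) ++ z :: t.
have yP : y \notin P.
  move: yD; rewrite /P !(inE, mem_cat) yA /= !negb_or (negPf yt) => /and5P[-> _ _ -> ->] //.
have y1 : y != x1 by apply: contraTneq gy => ->; rewrite gi.
have pP : path g x1 P by case/andP: p.
have uP : uniq (x1 :: P) by case/andP: u.
have AP : {subset y :: x1 :: P <= A}.
  by move=> w; rewrite inE => /orP[/eqP->//|wP]; apply: sA; rewrite inE wP orbT.
have sP : size (y :: x1 :: P) = L by rewrite -sz.
have uyP : uniq (y :: x1 :: P) by apply/andP; split; rewrite // inE negb_or y1.
have pyP : path g y (x1 :: P) by apply/andP; split; rewrite // gs.
have [v [vA gv v1]] := mindeg x1 yA.
have vP : v \in P.
  apply: contraT => nvP.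
  have vy : v != y by apply: contraTneq gv => ->; rewrite gi.
  have p' : path g v (y :: x1 :: P) by apply/andP; split; rewrite // gs.
  have u' : uniq (v :: y :: x1 :: P).
    by apply/andP; split; rewrite // inE negb_or vy inE negb_or v1 nvP.
  have A' : {subset v :: y :: x1 :: P <= A}.
    by move=> w; rewrite inE => /orP[/eqP->//|]; apply: AP.
  have := maxL p' u' A'.
  have -> : size (v :: y :: x1 :: P) = L.+1 by rewrite -sP.
  by rewrite ltnn.
have [vt|vt] := boolP (v \in t).
  right; have [y' [t0 [t' [*]]]] := escape y v yD vt gy (or_intror gv).
  by exists y', t0, t'; split.
have shorter e1 e2 : P = e1 ++ v :: e2 -> lollipop [:: y, x1 & e1] v e2.
  move=> E; have pe : perm_eq (v :: [:: y, x1 & e1] ++ e2) (y :: x1 :: P).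
    by rewrite E; apply/permPl; apply: (perm_catCA [:: v] [:: y, x1 & e1] e2).
  move: (pP); rewrite E -cat_rcons cat_path last_rcons => /andP[p1 p2].
  split=> //; rewrite ?(perm_uniq pe) ?(perm_size pe) //.
    by rewrite /cycle !rcons_cons; apply/and3P; split; rewrite // gs.
  by move=> w; rewrite (perm_mem pe); apply: AP.
have [vd|vd] := boolP (v \in x2 :: d).
  left; have [e1 [e2 E]] := mem_split vd.
  apply: (IH [:: y, x1 & e1] v (e2 ++ z :: t)).
    by apply: shorter; rewrite /P E -catA.
  have /(congr1 size) := E; rewrite size_cat /= addnS => -[->].
  by rewrite !ltnS leq_addr.
(* Now y and x0 are both ends with the neighbours x1 and z, which is a fold. *)
have vz : v = z.
  by move: vP; rewrite /P mem_cat (negPf vd) inE (negPf vt) orbF => /eqP.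
exfalso; have lp' := shorter (x2 :: d) t; rewrite vz in lp'.
have Ny := lollipop_end (lp' erefl).
apply: (@nofold x0 y) => //; first by rewrite eq_sym.
by move=> w wA; rewrite N0 // Ny.
Qed.

(* The vertices of d next to z have degree 2. If the second and the next to last
   vertex of d both have a neighbour outside the cycle z :: d, then these
   neighbours are connected outside the cycle, which yields three paths of which
   one has length 0 modulo 3. *)
Lemma lollipop_reducible d z t :
  lollipop d z t -> 1 < size d -> adjacent_degree2.
Proof.
have [n] := ubnP (size d); elim: n => // n IHn in d z t *; rewrite ltnS => dn lp d1.
have md : size d %% 3 = 0.
  have [cc cu cA _] := lollipop_cycle lp.
  have d2 : 2 < size (rcons d z) by rewrite size_rcons.
  by have := cyc cA cu cc d2; rewrite size_rcons => /mod3_pred.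
case: d => [//|x0 [//|x1 d']] in lp md d1 dn *.
case/lastP: d' => [//|d' w0] in lp md d1 dn *.
case/lastP: d' => [|m w1] in lp md d1 dn *.
  (* Here d is x0, x1, w0, and both ends have the neighbours x1 and z: a fold. *)
  have x0A : x0 \in A by case: lp => _ _ _ sA _; apply: sA; rewrite !inE eqxx ?orbT.
  have w0A : w0 \in A by case: lp => _ _ _ sA _; apply: sA; rewrite !inE eqxx ?orbT.
  have xw : x0 != w0 by case: lp => _ _ /= /and3P[_]; rewrite !inE !negb_or => /and3P[].
  case: (nofold x0A w0A xw) => y yA; rewrite (lollipop_end lp) //.
  by rewrite (lollipop_end (lollipop_rev lp)).
rewrite /= !size_rcons in md dn.
have m0 : 0 < size m by case: (size m) md.
have [cc cu cA ct] := lollipop_cycle lp.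
have lpr := lollipop_rev lp.
have Er : rev [:: x0, x1 & rcons (rcons m w1) w0] = [:: w0, w1 & rev [:: x0, x1 & m]].
  by rewrite -!rcons_cons !rev_rcons.
have [d2 Ed] : exists d2, rev [:: x0, x1 & m] = head x0 (rev m) :: d2.
  rewrite !rev_cons; case: (lastP m) m0 => // m' w2 _.
  by rewrite rev_rcons /=; eexists.
have [x2 [d1' Ed1]] : exists x2 d1', rcons (rcons m w1) w0 = x2 :: d1'.
  by case: (m) => [|x2 m'] /=; [exists w1, [:: w0] | exists x2, (rcons (rcons m' w1) w0)].
have sz1 : size d1' = (size m).+1 by have /(congr1 size) := Ed1; rewrite !size_rcons /= => -[].
have sz2 : size d2 = (size m).+1 by have /(congr1 size) := Ed; rewrite size_rev /= => -[].
have IH d' z' t' : lollipop d' z' t' -> 1 < size d' < (size m).+4 -> adjacent_degree2.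
  by move=> lp' /andP[h1 h2]; apply: IHn lp' h1; apply: leq_trans h2 dn.
have esc1 : adjacent_degree2 \/ exists y t0 t',
    let D := [set v in A | v \notin z :: [:: x0, x1 & rcons (rcons m w1) w0]] in
    [/\ t = t0 :: t', y \in D, g x1 y &
      connect [rel u v | [&& u \in D, v \in D & g u v]] y t0].
  by move: lp; rewrite Ed1 => lp; apply: (lollipop_escape lp); rewrite sz1.
case: esc1 => // -[y [t0 [t' [tE yD gy cy]]]].
have Dr : [set v in A | v \notin z :: rev [:: x0, x1 & rcons (rcons m w1) w0]] =
    [set v in A | v \notin z :: [:: x0, x1 & rcons (rcons m w1) w0]].
  by apply/setP => v; rewrite !in_set !in_cons mem_rev !in_cons.
have esc2 : adjacent_degree2 \/ exists y t0 t',
    let D := [set v in A | v \notin z :: [:: x0, x1 & rcons (rcons m w1) w0]] in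
    [/\ t = t0 :: t', y \in D, g w1 y &
      connect [rel u v | [&& u \in D, v \in D & g u v]] y t0].
  rewrite -Dr; move: lpr; rewrite Er Ed => lpr.
  by apply: (lollipop_escape lpr); rewrite sz2.
case: esc2 => // -[y' [t0' [t'' [tE' yD' gy' cy']]]].
move: tE'; rewrite tE => -[? _]; subst t0'.
set D := [set v in A | _] in yD yD' cy cy'.
have cs : connect_sym [rel u v | [&& u \in D, v \in D & g u v]].
  by apply: sym_connect_sym => a b; rewrite /= gs andbCA.
have cyy' : connect [rel u v | [&& u \in D, v \in D & g u v]] y y'.
  by apply: connect_trans cy _; rewrite cs.
have Erot : rot 1 (rcons [:: x0, x1 & rcons (rcons m w1) w0] z) = x1 :: m ++ [:: w1; w0; z; x0].
  by rewrite !rcons_cons rot1_cons !rcons_cons -!cats1 -!catA.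
(* The path joining the two escapes gives [size m] residue 1, whereas [size d], which is
   [size m + 4], is divisible by 3. *)
have := @cycle_ear_mod3 x1 w1 m [:: w0; z; x0] D y y'.
rewrite -Erot rot_cycle rot_uniq => /(_ cc cu) h.
suff m1 : size m %% 3 = 1 by move: md; rewrite -addn4 -modnDml m1.
apply: h => //; rewrite ?addnS //.
- by move=> v; rewrite mem_rot; apply: cA.
- by apply/subsetP => v; rewrite inE => /andP[].
- by move=> v; rewrite inE mem_rot mem_rcons => /andP[].
Qed.

End Longest.

(** All neighbours of the first vertex of a longest path lie on the path; one other than its
    successor closes a lollipop. *)
Lemma exists_adjacent_degree2 : A != set0 -> adjacent_degree2.
Proof.
case/set0Pn => x xA.
pose P n := `[< exists x s, [/\ path g x s, uniq (x :: s), {subset x :: s <= A} & size (x :: s) = n] >].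
have exP : exists n, P n.
  exists 1; apply/asboolP; exists x, [::]; split=> // v.
  by rewrite inE => /eqP->.
have bP n : P n -> n <= #|T|.
  by move=> /asboolP[y [s [_ u _ <-]]]; rewrite -(card_uniqP u) max_card.
case: (ex_maxnP exP bP) => L /asboolP[x0 [s [p u sA sz]]] maxP.
have maxL y s' : path g y s' -> uniq (y :: s') -> {subset y :: s' <= A} ->
    size (y :: s') <= L.
  by move=> p' u' sA'; apply: maxP; apply/asboolP; exists y, s'.
have x0A : x0 \in A by apply: sA; rewrite inE eqxx.
have nb v : v \in A -> g x0 v -> v \in s.
  move=> vA gv; apply: contraT => vs.
  have vx : v != x0 by apply: contraTneq gv => ->; rewrite gi.
  have p' : path g v (x0 :: s) by apply/andP; split; [rewrite gs|].
  have u' : uniq (v :: x0 :: s) by apply/andP; split; rewrite // in_cons negb_or vx.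
  have sA' : {subset v :: x0 :: s <= A} by move=> w; rewrite inE => /orP[/eqP->|/sA].
  by have := maxL _ _ p' u' sA'; rewrite -sz ltnn.
have [v0 [v0A gv0 _]] := mindeg x0 x0A; have := nb _ v0A gv0.
case: s => // x1 s in p u sA sz nb * => _.
have [v [vA gv vx1]] := mindeg x1 x0A.
have := nb _ vA gv; rewrite inE (negPf vx1) /= => /mem_split[e1 [e2 E]].
apply: (lollipop_reducible maxL (d := [:: x0, x1 & e1]) (z := v) (t := e2)) => //.
have pe : perm_eq (v :: [:: x0, x1 & e1] ++ e2) (x0 :: x1 :: s).
  by rewrite E; apply/permPl; apply: (perm_catCA [:: v] [:: x0, x1 & e1] e2).
have [g01 p0] : g x0 x1 /\ path g x1 s by apply/andP.
move: p0; rewrite E -cat_rcons cat_path last_rcons => /andP[p1 p2].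
split=> //; rewrite ?(perm_uniq pe) ?(perm_size pe) //.
  by rewrite /cycle !rcons_cons; apply/and3P; split; rewrite // gs.
by move=> w; rewrite (perm_mem pe); apply: sA.
Qed.

End Cycles.

(** * Induced matchings *)

Section InducedMatchings.
Variable (T : finType).
Implicit Types (g : rel T) (A S : {set T}).

(* An induced matching is encoded by the set S of its vertices: every vertex of
   S has exactly one neighbour in S. *)
Definition induced_matching g A S : bool :=
  (S \subset A) && [forall x in S, #|[set y in S | g x y]| == 1].

(* This counts vertices, hence twice the number of edges. *)
Definition matching_size g A := \max_(S | induced_matching g A S) #|S|.

Lemma induced_matchingP g A S :
  reflect ({subset S <= A} /\ forall x, x \in S ->
             exists y, [/\ y \in S, g x y & forall z, z \in S -> g x z -> z = y])
          (induced_matching g A S).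
Proof.
apply: (iffP andP) => [[/subsetP SA /forall_inP h]|[SA h]].
  split=> // x /h/cards1P[y E]; exists y.
  have: y \in [set y in S | g x y] by rewrite E set11.
  rewrite inE => /andP[yS gxy]; split=> // z zS gz.
  by apply/set1P; rewrite -E inE zS.
split; first exact/subsetP.
apply/forall_inP => x /h[y [yS gxy uy]]; apply/cards1P; exists y.
apply/setP => z; rewrite !inE; apply/andP/eqP => [[]|->//]; exact: uy.
Qed.

Lemma leq_matching_size g A S : induced_matching g A S -> #|S| <= matching_size g A.
Proof. by move=> mS; apply: (leq_bigmax_cond (F := fun S : {set T} => #|S|)). Qed.

Lemma matching_size_attained g A :
  exists2 S, induced_matching g A S & #|S| = matching_size g A.
Proof.
have m0 : induced_matching g A set0.
  by apply/induced_matchingP; split=> [x|x]; rewrite inE.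
have : 0 < #|[pred S | induced_matching g A S]| by apply/card_gt0P; exists set0.
by case/(eq_bigmax_cond (fun S : {set T} => #|S|)) => S mS E; exists S.
Qed.

Lemma matching_size_geP g A n :
  (forall S, induced_matching g A S -> #|S| <= n) -> matching_size g A <= n.
Proof. by move=> h; apply/bigmax_leqP. Qed.

Lemma matching_size_le_card g A : matching_size g A <= #|A|.
Proof. by apply: matching_size_geP => S /andP[/subset_leq_card]. Qed.

(** Closure under neighbours in S makes S' a union of matching edges; g' has to agree with g only on
    S'. *)
Lemma induced_matching_sub g g' A A' S S' : induced_matching g A S ->
    S' \subset S -> S' \subset A' ->
    (forall x y, x \in S' -> y \in S -> g x y -> y \in S') ->
    (forall x y, x \in S' -> y \in S' -> g' x y = g x y) ->
  induced_matching g' A' S'.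
Proof.
move=> /induced_matchingP[SA h] /subsetP s /subsetP s' cl E.
apply/induced_matchingP; split=> // x xS'; have [y [yS gxy uy]] := h x (s _ xS').
have yS' := cl _ _ xS' yS gxy.
by exists y; split; rewrite ?E // => z zS'; rewrite E //; apply/uy/s.
Qed.

Lemma card_setD2 S x y : #|S| <= #|S :\ x :\ y|.+2.
Proof. by rewrite (cardsD1 x) (cardsD1 y (S :\ x)); do 2!case: (_ \in _); lia. Qed.

Section Graph.
Variable g : rel T.
Hypotheses (gs : symmetric g) (gi : irreflexive g).

Lemma induced_matching_partner A S x y z : induced_matching g A S ->
  x \in S -> y \in S -> z \in S -> g x y -> g x z -> y = z.
Proof.
move=> /induced_matchingP[_ h] xS yS zS gxy gxz; have [t [_ _ ut]] := h _ xS.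
by rewrite (ut y) // (ut z).
Qed.

(** S must contain w, with a partner w'. If u were in S, its partner would be adjacent to w as well.
    If u had a neighbour in S, this would be w', and exchanging w for u would give an equally large
    matching without w. *)
Lemma matching_fold A S u w : u \in A -> w \in A -> u != w ->
    (forall y, y \in A -> g u y -> g w y) ->
    induced_matching g A S -> matching_size g (A :\ w) < #|S| ->
  forall x, x \in S -> x != u /\ ~~ g u x.
Proof.
move=> uA wA uw dom mS lt; have /induced_matchingP[SA h] := mS.
have wS : w \in S.
  apply: contraLR lt => wS; rewrite -leqNgt; apply: leq_matching_size.
  apply: (induced_matching_sub mS) => //.
  by apply/subsetP => x xS; rewrite !inE SA // andbT; apply: contraNneq wS => <-.
have [w' [w'S gww' uw']] := h _ wS.
have uS : u \notin S.
  apply/negP => uS; have [u' [u'S guu' _]] := h _ uS.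
  have gwu' := dom _ (SA _ u'S) guu'; case/negP: uw; apply/eqP.
  by apply: (induced_matching_partner mS u'S); rewrite // gs.
move=> x xS; split; first by apply: contraNneq uS => <-.
apply/negP => gux; have xw' : x = w' by apply: uw' => //; apply: dom; rewrite ?SA.
rewrite {x xS}xw' in gux.
suff : #|S| <= matching_size g (A :\ w) by rewrite leqNgt lt.
have <- : #|u |: S :\ w| = #|S|.
  by rewrite cardsU1 !inE (negPf uS) andbF (cardsD1 w S) wS.
have w'w : w' != w by apply: contraTneq gww' => ->; rewrite gi.
apply/leq_matching_size/induced_matchingP; split.
  by move=> x /setU1P[->|/setD1P[xw /SA xA]]; rewrite !inE ?uw ?xw.
have gu z : z \in S -> g u z -> z = w'.
  by move=> zS guz; apply: uw' => //; apply: dom; rewrite ?SA.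
move=> x /setU1P[->|/setD1P[xw xS]].
  exists w'; rewrite !inE w'w w'S orbT; split=> // z /setU1P[->|/setD1P[_ zS]].
    by rewrite gi.
  exact: gu.
have [->|xw'] := eqVneq x w'.
  exists u; rewrite setU11 gs; split=> // z /setU1P[->//|/setD1P[zw zS]] gz.
  case/negP: zw; apply/eqP; apply: (induced_matching_partner mS w'S zS wS gz).
  by rewrite gs.
have [y [yS gxy uy]] := h _ xS; exists y.
have yw : y != w.
  by apply: contraNneq xw' => yw; apply/eqP/uw' => //; rewrite gs -yw.
rewrite !inE yw yS orbT; split=> // z /setU1P[->|/setD1P[_ zS]]; last exact: uy.
by rewrite gs => /(gu _ xS) E; rewrite E eqxx in xw'.
Qed.

Lemma matching_K2 A u v : u \in A -> v \in A ->
    (forall y, y \in A -> g u y = (y == v)) -> (forall y, y \in A -> g v y = (y == u)) ->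
  matching_size g A = (matching_size g (A :\ u :\ v)).+2.
Proof.
move=> uA vA Nu Nv; have guv : g u v by rewrite Nu.
have uv : u != v by apply: contraTneq guv => ->; rewrite gi.
apply/eqP; rewrite eqn_leq; apply/andP; split.
  apply: matching_size_geP => S mS; apply: leq_trans (card_setD2 S u v) _.
  rewrite !ltnS; apply: leq_matching_size.
  have /induced_matchingP[SA _] := mS.
  apply: (induced_matching_sub mS) => //.
  - by rewrite setDDl subsetDl.
  - by rewrite !setDDl; apply: setSD; apply/subsetP.
  - move=> x y /setD1P[xv /setD1P[xu xS]] yS gxy; rewrite !inE yS andbT.
    apply/andP; split.
      by apply: contraTneq gxy => ->; rewrite gs Nv ?SA.
    by apply: contraTneq gxy => ->; rewrite gs Nu ?SA.
have [S mS <-] := matching_size_attained g (A :\ u :\ v).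
have /induced_matchingP[SA h] := mS.
have SA' x : x \in S -> [/\ x != u, x != v & x \in A].
  by move/SA; rewrite !inE => /and3P[].
have uS : u \notin S by apply/negP => /SA'[]; rewrite eqxx.
have vS : v \notin S by apply/negP => /SA'[_]; rewrite eqxx.
have -> : #|S|.+2 = #|u |: (v |: S)|.
  by rewrite !cardsU1 !inE (negPf uv) (negPf uS) vS.
apply/leq_matching_size/induced_matchingP; split.
  by move=> x /setU1P[->//|/setU1P[->//|/SA'[]]].
move=> x /setU1P[->|/setU1P[->|xS]].
- exists v; rewrite !inE eqxx orbT; split=> // z /setU1P[->|/setU1P[->//|zS]]; rewrite ?gi //.
  by rewrite Nu ?(SA' z zS).2 //; [move/eqP | case: (SA' z zS)].
- exists u; rewrite !inE eqxx gs; split=> // z /setU1P[->//|/setU1P[->|zS]]; rewrite ?gi //.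
  by rewrite Nv; [move/eqP | case: (SA' z zS)].
- have [xu xv xA] := SA' _ xS.
  have [y [yS gxy uy]] := h _ xS; exists y; rewrite !inE yS !orbT; split=> //.
  move=> z /setU1P[->|/setU1P[->|zS]]; last exact: uy.
    by rewrite gs Nu // (negPf xv).
  by rewrite gs Nv // (negPf xu).
Qed.

(** * Contraction: cycle lengths and matching size *)

Section Contract.
Variables (A : {set T}) (a p q b : T).
Hypotheses (aA : a \in A) (pA : p \in A) (qA : q \in A) (bA : b \in A)
  (aq : a != q) (pb : p != b) (ab : a != b) (ngab : ~~ g a b)
  (Np : forall y, y \in A -> g p y = (y == a) || (y == q))
  (Nq : forall y, y \in A -> g q y = (y == p) || (y == b))
  (cyc : cycles_mod3 g A).

Let gpa : g p a. Proof. by rewrite Np // eqxx. Qed.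
Let gpq : g p q. Proof. by rewrite Np // eqxx orbT. Qed.
Let gqb : g q b. Proof. by rewrite Nq // eqxx orbT. Qed.
Let pa : p != a. Proof. by apply: contraTneq gpa => ->; rewrite gi. Qed.
Let pq : p != q. Proof. by apply: contraTneq gpq => ->; rewrite gi. Qed.
Let qb : q != b. Proof. by apply: contraTneq gqb => ->; rewrite gi. Qed.

Let gba : g b a = false. Proof. by rewrite gs (negPf ngab). Qed.
Let gbp : g b p = false.
Proof. by rewrite gs Np // [b == a]eq_sym (negPf ab) [b == q]eq_sym (negPf qb). Qed.

(** A common neighbour of a and b would close a cycle of length 5 through p and q. *)
Lemma contract_common x : x \in A -> g a x -> ~~ g b x.
Proof.
move=> xA gax; apply/negP => gbx.
have xa : x != a by apply: contraTneq gax => ->; rewrite gi.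
have xb : x != b by apply: contraTneq gbx => ->; rewrite gi.
have xp : x != p.
  by apply: contraTneq gbx => ->; rewrite gs Np // [b == a]eq_sym (negPf ab) eq_sym (negPf qb).
have xq : x != q.
  by apply: contraTneq gax => ->; rewrite gs Nq // eq_sym (negPf pa) (negPf ab).
have := @cyc [:: a; p; q; b; x]; rewrite /= andbT [g a p]gs gpa gpq gqb gbx [g x a]gs gax.
move=> h; suff : 5 %% 3 = 1 by [].
apply: h => //.
  by move=> y; rewrite !inE => /or4P[/eqP->|/eqP->|/eqP->|/orP[]/eqP->].
by rewrite !inE !negb_or [a == p]eq_sym pa aq ab pq pb qb ![_ == x]eq_sym xa xp xq xb.
Qed.

(** A cycle through the merged node lifts according to its two edges there: both come from a, both
    from b, or one from each. In the mixed case the path a - p - q - b replaces a, with three more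
    nodes. *)
Lemma contract_cycles : cycles_mod3 (merge_edges g a b) (A :\ p :\ q :\ b).
Proof.
set g' := merge_edges g a b.
have g'E : {in predC1 a &, g' =2 g}.
  by move=> x y; rewrite !inE => xa ya; rewrite /g' /merge_edges (negPf xa) (negPf ya) !orbF.
have g's : symmetric g' by move=> x y; rewrite /g' /merge_edges gs [X in _ || X]orbC.
move=> s sA u c sz.
have sA' x : x \in s -> [/\ x != p, x != q, x != b & x \in A].
  by move/sA; rewrite !inE => /and4P[-> -> -> ->].
have [as_|as_] := boolP (a \in s); last first.
  apply: cyc => //; first by move=> x /sA'[].
  rewrite -(eq_in_cycle g'E) //; apply/allP => x xs /=.
  by apply: contraNneq as_ => <-.
have [i s' rE] := rot_to as_.
rewrite -(size_rot i) rE; move: u c; rewrite -(rot_uniq i) -(rot_cycle i) rE.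
have {}sA' x : x \in a :: s' -> [/\ x != p, x != q, x != b & x \in A].
  by rewrite -rE mem_rot; apply: sA'.
have {rE sA as_ sz} sz : 2 < size (a :: s') by rewrite -rE size_rot.
case: s' => [//|h s'] in sA' sz *; case/lastP: s' => [//|m l] in sA' sz *.
set s0 := h :: rcons m l => u; have [as0 us0] : a \notin s0 /\ uniq s0 by apply/andP.
rewrite /cycle rcons_path => /andP[/= /andP[gah pm] gla].
have {pm} pm : path g h (rcons m l).
  rewrite -(eq_in_path g'E) //; apply/allP => x xs /=.
  by apply: contraNneq as0 => <-.
have {}gla : g' a l by move: gla; rewrite last_rcons g's.
have hs : h \in s0 by rewrite inE eqxx.
have ls : l \in s0 by rewrite inE mem_rcons inE eqxx orbT.
have na x : x \in s0 -> x != a by move=> xs; apply: contraNneq as0 => <-.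
have nb x : x \in s0 -> g' a x -> g a x || g b x.
  by move=> /na xa; rewrite /g' /merge_edges eqxx (negPf xa) orbF.
have inA x : x \in s0 -> x \in A by move=> xs; case: (sA' x) => //; rewrite inE xs orbT.
have out x : x \in [:: p; q; b] -> x \notin s0.
  move=> xo; apply/negP => xs.
  have xs' : x \in a :: s0 by rewrite inE xs orbT.
  have [xp xq xb _] := sA' x xs'.
  by move: xo; rewrite !inE (negPf xp) (negPf xq) (negPf xb).
have cyc' t : uniq (t ++ s0) -> {subset t <= A} -> cycle g (t ++ s0) -> 2 < size (t ++ s0) ->
    size (t ++ s0) %% 3 = 1.
  by move=> ut tA ct; apply: cyc => // x; rewrite mem_cat => /orP[/tA|/inA].
have s0sz : 1 < size s0 by rewrite /= size_rcons.
have end2 t0 t : g (last t0 t) h -> g l t0 -> path g t0 t -> cycle g ((t0 :: t) ++ s0).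
  move=> e1 e2 pt; rewrite /cycle cat_cons rcons_path cat_path pt /= e1 pm /=.
  by rewrite last_cat /= last_rcons.
have usz t : uniq t -> {in t, forall x, x \notin s0} -> uniq (t ++ s0).
  by move=> ut dt; rewrite cat_uniq ut us0 andbT -all_predC; apply/allP => x xs /=;
     apply: contraL xs => /dt.
have outn x : x \in [:: a; p; q; b] -> x \notin s0.
  by rewrite inE => /orP[/eqP->//|]; apply: out.
have close t0 t : uniq (t0 :: t) -> {subset t0 :: t <= [:: a; p; q; b]} ->
    g (last t0 t) h -> g l t0 -> path g t0 t -> size (t0 :: t ++ s0) %% 3 = 1.
  move=> ut st e1 e2 pt; apply: (cyc' (t0 :: t)).
  - by apply: usz => // x /st/outn.
  - by move=> x /st; rewrite !inE => /or4P[]/eqP->.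
  - exact: end2.
  - by rewrite size_cat addSn ltnS; apply: leq_trans s0sz (leq_addl _ _).
case/orP: (nb _ hs gah) => [nh|nh]; case/orP: (nb _ ls gla) => [nl|nl].
- by apply: (close a [::]) => //=; [move=> x; rewrite !inE => -> | rewrite gs].
- rewrite -(modnDl _ 3); apply: (close b [:: q; p; a]) => //=.
  + by rewrite !inE !negb_or [b == q]eq_sym qb [b == p]eq_sym pb [b == a]eq_sym ab
       [q == p]eq_sym pq [q == a]eq_sym aq pa.
  + by move=> x; rewrite !inE => /or4P[]->; rewrite ?orbT.
  + by rewrite gs.
  + by rewrite [g b q]gs gqb [g q p]gs gpq gpa.
- rewrite -(modnDl _ 3); apply: (close a [:: p; q; b]) => //=.
  + by rewrite !inE !negb_or qb pb ab pq aq [a == p]eq_sym pa.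
  + by rewrite gs.
  + by rewrite [g a p]gs gqb gpq gpa.
- apply: (close b [::]) => //=; first by move=> x; rewrite !inE => ->; rewrite !orbT.
  by rewrite gs.
Qed.

Let b_notin_Np z : g b z -> z \in A -> z != p.
Proof.
move=> gbz zA; apply: contraTneq gbz => ->.
by rewrite gs Np // [b == a]eq_sym (negPf ab) eq_sym (negPf qb).
Qed.

(** The new edges join a to neighbours of b, so they do harm only if a and a neighbour of b both
    remain in S. The cases are split by which of p and q lie in S. *)
Lemma contract_matching_le :
  matching_size g A <= (matching_size (merge_edges g a b) (A :\ p :\ q :\ b)).+2.
Proof.
apply: matching_size_geP => S mS; have /induced_matchingP[SA h] := mS.
set g' := merge_edges g a b; set A' := A :\ p :\ q :\ b.
have uS := induced_matching_partner mS.
(* It mostly suffices to remove one edge xy of the matching. *)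
have drop x y : x \in S -> y \in S -> g x y ->
    (forall z, z \in S :\ x :\ y -> [/\ z != p, z != q & z != b]) ->
    (a \in S :\ x :\ y -> forall z, z \in S :\ x :\ y -> ~~ g b z) ->
    #|S| <= (matching_size g' A').+2.
  move=> xS yS gxy S'A' nb; apply: leq_trans (card_setD2 S x y) _; rewrite !ltnS.
  apply: leq_matching_size; apply: (induced_matching_sub mS).
  - by rewrite setDDl subsetDl.
  - apply/subsetP => z zS'; have [zp zq zb] := S'A' _ zS'.
    by move: zS'; rewrite !inE zp zq zb => /and3P[_ _ /SA].
  - move=> z t; rewrite !inE => /and3P[zy zx zS] tS gzt; rewrite tS andbT.
    apply/andP; split.
      apply: contraNneq zx => ty; apply/eqP.
      by apply: (uS y z x) => //; rewrite gs // -ty.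
    apply: contraNneq zy => tx; apply/eqP.
    by apply: (uS x z y) => //; rewrite gs -tx.
  - move=> z t zS tS; rewrite /g' /merge_edges.
    case: eqVneq => [za|_] /=.
      rewrite za in zS *; rewrite (negPf (nb zS _ tS)) /=.
      by case: eqVneq => [ta|_] /=; rewrite ?orbF // (negPf (nb zS _ zS)) orbF.
    case: eqVneq => [ta|_] /=; rewrite ?orbF //.
    by rewrite ta in tS *; rewrite (negPf (nb tS _ zS)) orbF.
have nS x y z : x \in S -> y \in S -> g x y -> g x z -> z \in S :\ y -> False.
  by move=> xS yS gxy gxz /setD1P[zy zS]; case/negP: zy; apply/eqP; apply: (uS x).
have [pS|pS] := boolP (p \in S); have [qS|qS] := boolP (q \in S).
- apply: (drop p q) => //.
    move=> z /setD1P[zq /setD1P[zp zS]]; split=> //.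
    apply: contraTneq zS => ->; apply/negP => bS.
    by case: (nS q p b) => //; rewrite ?inE 1?eq_sym ?bS ?pb // gs.
  move=> /setD1P[_ /setD1P[_ aS]].
  by case: (nS p q a) => //; rewrite !inE aq aS.
- have [y [yS gpy _]] := h _ pS.
  have aS : a \in S.
    move: (gpy); rewrite Np ?SA // => /orP[]/eqP yE; first by rewrite -yE.
    by rewrite -yE yS in qS.
  have [bS|bS] := boolP (b \in S); last first.
    apply: (drop p a) => //; last by rewrite !inE eqxx.
    move=> z /setD1P[za /setD1P[zp zS]]; split=> //; first by apply: contraNneq qS => <-.
    by apply: contraNneq bS => <-.
  (* The merged vertex a inherits the partner b' of b. *)
  have [b' [b'S gbb' ub']] := h _ bS.
  have b'a : b' != a by apply: contraNneq ngab => <-; rewrite gs.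
  have b'p : b' != p by apply: b_notin_Np; rewrite ?SA.
  have b'b : b' != b by apply: contraTneq gbb' => ->; rewrite gi.
  have b'q : b' != q by apply: contraNneq qS => <-.
  have na z : z \in S -> z != p -> g a z = false.
    move=> zS zp; apply/negP => gaz; case/negP: zp; apply/eqP.
    by apply: (uS a) => //; rewrite gs.
  apply: leq_trans (card_setD2 S p b) _; rewrite !ltnS.
  apply/leq_matching_size/induced_matchingP; split.
    move=> z; rewrite !inE => /and3P[zb zp zS]; rewrite zb zp SA // !andbT.
    by apply: contraNneq qS => <-.
  move=> x /setD1P[xb /setD1P[xp xS]]; have [xa|xa] := eqVneq x a.
    exists b'; rewrite xa !inE b'b b'p b'S /g' /merge_edges eqxx gbb' orbT; split=> //.
    move=> z /setD1P[zb /setD1P[zp zS]]; rewrite na //= gba andbF orbF.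
    exact: ub'.
  have [xb'|xb'] := eqVneq x b'.
    exists a; rewrite xb' !inE ab aS [a == p]eq_sym pa /g' /merge_edges eqxx gbb' !orbT.
    split=> // z /setD1P[zb /setD1P[zp zS]].
    rewrite (negPf b'a) /=; have [//|za] := eqVneq z a; rewrite orbF => gz.
    by case/negP: zb; apply/eqP; apply: (uS b') => //; rewrite // gs.
  have [t [tS gxt ut]] := h _ xS; exists t.
  have tp : t != p.
    by apply: contraNneq xa => tp; apply/eqP; apply: (uS p); rewrite // -tp gs.
  have tb : t != b.
    by apply: contraNneq xb' => tb; apply/eqP; apply: ub'; rewrite // -tb gs.
  rewrite !inE tp tb tS /g' /merge_edges gxt; split=> // z /setD1P[zb /setD1P[zp zS]].
  rewrite (negPf xa) /=; case/orP; first exact: ut.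
  by case/andP=> /eqP _ /(ub' _ xS) E; rewrite E eqxx in xb'.
- have [y [yS gqy _]] := h _ qS.
  have bS : b \in S.
    move: (gqy); rewrite Nq ?SA // => /orP[]/eqP yE; last by rewrite -yE.
    by rewrite -yE yS in pS.
  apply: (drop q b) => //.
    move=> z /setD1P[zb /setD1P[zq zS]]; split=> //.
    by apply: contraNneq pS => <-.
  move=> _ z /setD1P[zb /setD1P[zq zS]]; apply: contra zq => gbz; apply/eqP.
  by apply: (uS b); rewrite // gs.
- have nin z : z \in S -> z != p /\ z != q.
    by move=> zS; split; [apply: contraNneq pS => <- | apply: contraNneq qS => <-].
  have [bS|bS] := boolP (b \in S).
    have [b' [b'S gbb' ub']] := h _ bS; apply: (drop b b') => //.
      by move=> z /setD1P[zb' /setD1P[zb zS]]; have [] := nin _ zS.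
    move=> _ z /setD1P[zb' /setD1P[zb zS]]; apply: contra zb' => gbz; apply/eqP.
    exact: ub'.
  have nb z : z \in S -> z != b by move=> zS; apply: contraNneq bS => <-.
  have [aS|aS] := boolP (a \in S).
    have [a' [a'S gaa' _]] := h _ aS; apply: (drop a a') => //.
      by move=> z /setD1P[_ /setD1P[_ zS]]; have [] := nin _ zS; split=> //; apply: nb.
    by rewrite !inE eqxx andbF.
  do 2!apply: leqW; apply: leq_matching_size; apply: (induced_matching_sub mS) => //.
    apply/subsetP => z zS; have [zp zq] := nin _ zS.
    by rewrite !inE zp zq nb ?SA.
  have na z : z \in S -> z != a by move=> zS; apply: contraNneq aS => <-.
  by move=> x y xS yS; rewrite /g' /merge_edges (negPf (na _ xS)) (negPf (na _ yS)) !orbF.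
Qed.

(** A matching avoiding a is enlarged by pq. Otherwise let x be the partner of a: if ax is an old
    edge, bq is added, which [contract_common] permits; if ax comes from bx, it is replaced by bx
    and ap. *)
Lemma contract_matching_ge :
  (matching_size (merge_edges g a b) (A :\ p :\ q :\ b)).+2 <= matching_size g A.
Proof.
set g' := merge_edges g a b; set A' := A :\ p :\ q :\ b.
have [S mS <-] := matching_size_attained g' A'.
have /induced_matchingP[SA h] := mS.
have SA' x : x \in S -> [/\ x != b, x != q, x != p & x \in A].
  by move/SA; rewrite !inE => /and4P.
have g'E x y : x != a -> y != a -> g' x y = g x y.
  by move=> xa ya; rewrite /g' /merge_edges (negPf xa) (negPf ya) !orbF.
have sub x y : g x y -> g' x y by rewrite /g' /merge_edges => ->.
have card2 x y : x != y -> x \notin S -> y \notin S -> #|S|.+2 = #|x |: (y |: S)|.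
  by move=> xy xS yS; rewrite !cardsU1 !inE (negPf xy) (negPf xS) yS.
have pS : p \notin S by apply/negP => /SA'[]; rewrite eqxx.
have qS : q \notin S by apply/negP => /SA'[_]; rewrite eqxx.
have bS : b \notin S by apply/negP => /SA'[]; rewrite eqxx.
have [aS|aS] := boolP (a \in S); last first.
  have na z : z \in S -> z != a by move=> zS; apply: contraNneq aS => <-.
  rewrite (card2 p q) //; apply/leq_matching_size/induced_matchingP; split.
    by move=> x /setU1P[->//|/setU1P[->//|/SA'[]]].
  have npz z : z \in S -> g p z = false.
    by move=> zS; have [_ zq _ zA] := SA' _ zS; rewrite Np // (negPf (na _ zS)) (negPf zq).
  have nqz z : z \in S -> g q z = false.
    by move=> zS; have [zb _ zp zA] := SA' _ zS; rewrite Nq // (negPf zp) (negPf zb).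
  move=> x /setU1P[->|/setU1P[->|xS]].
  - exists q; rewrite !inE eqxx orbT; split=> // z /setU1P[->|/setU1P[->//|zS]].
      by rewrite gi.
    by rewrite npz.
  - exists p; rewrite !inE eqxx gs; split=> // z /setU1P[->//|/setU1P[->|zS]].
      by rewrite gi.
    by rewrite nqz.
  - have [y [yS gxy uy]] := h _ xS; rewrite g'E ?na // in gxy.
    exists y; rewrite !inE yS !orbT; split=> // z /setU1P[->|/setU1P[->|zS]].
    + by rewrite gs npz.
    + by rewrite gs nqz.
    + by move/sub; apply: uy.
have [x [xS gax ux]] := h _ aS.
have xa : x != a.
  apply: contraTneq gax => ->; rewrite /g' /merge_edges gi eqxx gs.
  by rewrite (negPf ngab).
have xA : x \in A by case: (SA' _ xS).
have ua z : z \in S -> g a z -> z = x by move=> zS /sub/ux; apply.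
have ub z : z \in S -> g b z -> z = x.
  by move=> zS gz; apply: ux; rewrite // /g' /merge_edges eqxx gz orbT.
have nqz z : z \in S -> g q z = false.
  by move=> zS; have [zb _ zp zA] := SA' _ zS; rewrite Nq // (negPf zp) (negPf zb).
have npz z : z \in S -> z != a -> g p z = false.
  by move=> zS za; have [_ zq _ zA] := SA' _ zS; rewrite Np // (negPf za) (negPf zq).
have gaq : g a q = false by rewrite gs Nq // [a == p]eq_sym (negPf pa) (negPf ab).
have gab : g a b = false by apply: negPf.
have other y : y \in S -> y != a -> y != x ->
    exists z, [/\ z \in S, g y z & forall t, t \in S -> g y t -> t = z].
  move=> yS ya yx; have [z [zS gyz uz]] := h _ yS.
  have za : z != a.
    apply: contraNneq yx => za; apply/eqP/ux => //.
    by move: gyz; rewrite za /g' /merge_edges gs [X in _ || X]orbC.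
  by exists z; rewrite -g'E //; split=> // t tS /sub; apply: uz.
have [gax'|ngax] := boolP (g a x).
  have nbx : ~~ g b x by apply: contract_common.
  have nbz z : z \in S -> g b z = false.
    by move=> zS; apply/negP => gz; case/negP: nbx; rewrite -(ub z).
  rewrite (card2 b q) // 1?eq_sym //; apply/leq_matching_size/induced_matchingP; split.
    by move=> y /setU1P[->//|/setU1P[->//|/SA'[]]].
  move=> y /setU1P[->|/setU1P[->|yS]].
  - exists q; rewrite !inE eqxx orbT gs; split=> // z /setU1P[->|/setU1P[->//|zS]].
      by rewrite gi.
    by rewrite nbz.
  - exists b; rewrite !inE eqxx; split=> // z /setU1P[->//|/setU1P[->|zS]].
      by rewrite gi.
    by rewrite nqz.
  have [z [zS gyz uz]] : exists z, [/\ z \in S, g y z & forall t, t \in S -> g y t -> t = z].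
    have [->|ya] := eqVneq y a; first by exists x.
    have [->|yx] := eqVneq y x; last exact: other.
    exists a; rewrite gs; split=> // t tS gxt.
    have [//|ta] := eqVneq t a; have [z [zS gxz uz]] := h _ xS.
    by rewrite (uz t tS (sub _ _ gxt)) -(uz a aS) // sub // gs.
  exists z; rewrite !inE zS !orbT; split=> // t /setU1P[->|/setU1P[->|tS]].
  - by rewrite gs nbz.
  - by rewrite gs nqz.
  - exact: uz.
have gbx : g b x.
  move: gax; rewrite /g' /merge_edges (negPf ngax) eqxx /= gba andbF orbF //.
have naz z : z \in S -> g a z = false.
  by move=> zS; apply/negP => gz; case/negP: ngax; rewrite -(ua z).
rewrite (card2 b p) // 1?eq_sym //; apply/leq_matching_size/induced_matchingP; split.
  by move=> y /setU1P[->//|/setU1P[->//|/SA'[]]].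
move=> y /setU1P[->|/setU1P[->|yS]].
- exists x; rewrite !inE xS !orbT; split=> // z /setU1P[->|/setU1P[->|zS]].
  + by rewrite gi.
  + by rewrite gbp.
  + exact: ub.
- exists a; rewrite !inE aS !orbT; split=> // z /setU1P[->|/setU1P[->|zS]].
  + by rewrite gs gbp.
  + by rewrite gi.
  + by have [//|za] := eqVneq z a; rewrite npz.
have [->|ya] := eqVneq y a.
  exists p; rewrite !inE eqxx orbT gs; split=> // z /setU1P[->|/setU1P[->//|zS]].
    by rewrite gab.
  by rewrite naz.
have [->|yx] := eqVneq y x.
  exists b; rewrite !inE eqxx gs; split=> // z /setU1P[->//|/setU1P[->|zS]].
    by rewrite gs npz.
  move=> gxz; have [za|za] := eqVneq z a; first by rewrite za gs (negPf ngax) in gxz.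
  have [w [wS gxw uw]] := h _ xS.
  case/negP: za; apply/eqP; rewrite (uw z zS (sub _ _ gxz)); apply/esym/uw => //.
  by rewrite /g' /merge_edges eqxx gbx !orbT.
have [z [zS gyz uz]] := other _ yS ya yx.
exists z; rewrite !inE zS !orbT; split=> // t /setU1P[->|/setU1P[->|tS]].
- by rewrite gs => /(ub _ yS) E; rewrite E eqxx in yx.
- by rewrite gs npz.
- exact: uz.
Qed.

End Contract.

End Graph.

End InducedMatchings.

(** * The induction on the number of nodes *)

Section GraphHomology.
Variables (T : finType) (r : T -> nat).
Hypothesis r_inj : injective r.
Implicit Types (g : rel T) (A C S : {set T}).

Lemma induced_matching_leq g A A' S : induced_matching g A S -> S \subset A' ->
  #|S| <= matching_size g A'.
Proof.
by move=> mS sA'; apply: leq_matching_size; apply: (induced_matching_sub mS).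
Qed.

Lemma cycles_mod3_sub g A A' : A' \subset A -> cycles_mod3 g A -> cycles_mod3 g A'.
Proof. by move=> /subsetP sA cyc s sA'; apply: cyc => x /sA'/sA. Qed.

Definition sphere_homology (X : {set {set T}}) d :=
  cyclic_homology r X d /\ forall n, n <> d -> trivial_homology r X n.

Lemma same_homology_sphere X Y d :
  same_homology r X Y -> sphere_homology Y d -> sphere_homology X d.
Proof.
by move=> XY [cY tY]; split=> [|n nd]; [apply/(XY d).2 | apply/(XY n).1/tY].
Qed.

(* Chains are graded by complements of independent sets, so that d is the number
   of vertices outside C minus the maximal number of edges of an induced
   matching; the equation is doubled. *)
Definition small_homology g C A :=
  let X := cofamily (indep_family g C A) in
  (forall n, trivial_homology r X n) \/
  exists2 d, (d + #|C|).*2 + matching_size g A = #|T|.*2 & sphere_homology X d.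

(** C is the only set in the family, so the complex has a single generator. *)
Lemma small_homology0 g C : small_homology g C set0.
Proof.
right; exists #|~: C|.
  have := matching_size_le_card g set0; rewrite cards0 leqn0 => /eqP->.
  by rewrite addn0 addnC cardsC.
have -> : cofamily (indep_family g C set0) = [set ~: C].
  apply/setP => Q; rewrite !inE -(inj_eq (@setC_inj T)) setCK.
  apply/indep_familyP/eqP => [[CU UC _]|<-].
    apply/setP => x; apply/idP/idP => [/UC[]//|/CU//].
    by rewrite inE.
  by split=> [//|x xC|x y _]; [left|rewrite inE].
split=> [|n /eqP nd]; [exact: homology_set1_card | exact: homology_set1].
Qed.

Lemma graph_homology g A C : symmetric g -> irreflexive g ->
  cycles_mod3 g A -> [disjoint C & A] -> small_homology g C A.
Proof.
have [n] := ubnP #|A|; elim: n => // n IHn in g A C *.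
rewrite ltnS => An gs gi cyc dCA.
have [->|A0] := eqVneq A set0; first exact: small_homology0.
have ltA x A' : x \in A -> A' \subset A :\ x -> #|A'| < n.
  by move=> xA /subset_leq_card; rewrite (cardsD1 x A) xA in An; lia.
have [[u [uA iso]]|noiso] := pselect (exists u, u \in A /\ forall y, y \in A -> ~~ g u y).
  left=> m; apply: (indep_isolated r_inj gs gi uA _ iso).
  by apply: contraL uA => /(disjointFr dCA) ->.
have [[u [w [uA wA uw dom]]]|nofold] := pselect (exists u w,
    [/\ u \in A, w \in A, u != w & forall y, y \in A -> g u y -> g w y]).
  have dC A' : A' \subset A -> [disjoint C & A'] by move/disjointWr; apply.
  have fold := indep_fold r_inj gs gi uA wA uw dCA dom.
  have IH x : x \in A -> small_homology g C (A :\ x).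
    move=> xA; apply: IHn => //; [exact: ltA xA _ | | exact/dC/subsetDl].
    exact: cycles_mod3_sub (subsetDl _ _) cyc.
  have [tr|[d dE sd]] := IH _ wA.
    by left=> m; apply/(fold m).1.
  have sX := same_homology_sphere fold sd.
  have [S mS SE] := matching_size_attained g A.
  have [ltS|geS] := ltnP (matching_size g (A :\ w)) #|S|; last first.
    right; exists d => //; rewrite -dE; congr (_ + _).
    apply/eqP; rewrite -SE eqn_leq geS; have [S' mS' <-] := matching_size_attained g (A :\ w).
    have /andP[S'A _] := mS'.
    by rewrite SE (induced_matching_leq mS') // (subset_trans S'A) // subsetDl.
  (* The fold puts a nonzero class in degree d, which is tied to the matching size of [A :\ w]. But
     S survives in both [A :\ u] and L, which therefore have larger matching sizes, and for the link
     C also gains u. Both counts exclude degree d, so deletion and link vanish there, and exactness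
     gives a contradiction. *)
  exfalso; have avoid := matching_fold gs gi uA wA uw dom mS ltS.
  have /andP[/subsetP SA _] := mS.
  apply: (trivial_not_cyclic _ sX.1); apply: (indep_delete_link r_inj gs gi uA dCA).
    have leS : #|S| <= matching_size g (A :\ u).
      apply: (induced_matching_leq mS); apply/subsetP => x xS.
      by rewrite !inE SA // andbT; case: (avoid _ xS).
    have [tr|[d1 d1E [_ tr]]] := IH _ uA; first exact: tr.
    by apply: tr => dd; move: d1E; rewrite -dE -dd; lia.
  set L := [set x in A :\ u | ~~ g u x].
  have LA : L \subset A :\ u by apply/subsetP => x; rewrite inE => /andP[].
  have leS : #|S| <= matching_size g L.
    apply: (induced_matching_leq mS); apply/subsetP => x xS.
    by have [xu ux] := avoid _ xS; rewrite !inE SA // xu.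
  have uC : u \notin C by apply: contraL uA => /(disjointFr dCA) ->.
  have := IHn g L (u |: C) (ltA _ _ uA LA) gs gi (cycles_mod3_sub (subset_trans LA (subsetDl _ _)) cyc).
  case.
  - rewrite disjoints_subset; apply/subsetP => x /setU1P[->|xC]; rewrite !inE ?eqxx //.
    by rewrite (disjointFr dCA xC) andbF.
  - exact.
  - move=> [d2 d2E [_ tr]]; apply: tr => dd; move: d2E.
    by rewrite cardsU1 uC -dE -dd; lia.
have [[u [v [uA vA Nu Nv]]]|noK2] := pselect (exists u v, [/\ u \in A, v \in A,
    forall y, y \in A -> g u y = (y == v) & forall y, y \in A -> g v y = (y == u)]).
  have leaf := indep_leaf r_inj gs gi uA vA dCA Nu Nv.
  have uC : u \notin C by apply: contraL uA => /(disjointFr dCA) ->.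
  have sA : A :\ u :\ v \subset A by rewrite setDDl subsetDl.
  have := IHn g (A :\ u :\ v) (u |: C) (ltA _ _ uA (subsetDl _ _)) gs gi (cycles_mod3_sub sA cyc).
  case.
  - rewrite disjoints_subset; apply/subsetP => x /setU1P[->|xC]; rewrite !inE ?eqxx ?andbF //.
    by rewrite (disjointFr dCA xC) !andbF.
  - by move=> tr; left=> m; apply/(leaf m).1.
  - move=> [d dE sd]; right; exists d; last exact: same_homology_sphere leaf sd.
    by rewrite -dE (matching_K2 gs gi uA vA Nu Nv) cardsU1 uC add1n !addnS doubleS !addSn.
have nofold' u w : u \in A -> w \in A -> u != w ->
    ~ (forall y, y \in A -> g u y -> g w y).
  by move=> uA wA uw dom; apply: nofold; exists u, w.
have deg u : u \in A -> exists2 v, v \in A & g u v.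
  move=> uA; apply: contrapT => nex; apply: noiso; exists u; split=> // y yA.
  by apply/negP => guy; apply: nex; exists y.
(* If v were the only neighbour of u, another neighbour of v would give a fold, so u and v would
   form a component. *)
have mindeg u v : u \in A -> exists w, [/\ w \in A, g u w & w != v].
  move=> uA; have [v0 v0A gv0] := deg _ uA.
  have [E|nv] := eqVneq v0 v; last by exists v0.
  subst v0; apply: contrapT => nex.
  have Nu y : y \in A -> g u y -> y = v.
    move=> yA gy; apply: contrapT => /eqP yv; apply: nex; exists y; split=> //.
  apply: noK2; exists u, v; split=> // y yA.
    by apply/idP/eqP => [/Nu->|->].
  apply/idP/eqP => [gvy|->]; last by rewrite gs.
  apply: contrapT => /eqP yu; case: (nofold' u y) => //; first by rewrite eq_sym.
  by move=> z zA /(Nu _ zA)->; rewrite gs.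
have [p [q [a [b [[pA qA aA bA] aq pb Np Nq]]]]] :=
  exists_adjacent_degree2 gs gi cyc nofold' mindeg A0.
have gpa : g p a by rewrite Np // eqxx.
have gpq : g p q by rewrite Np // eqxx orbT.
have gqb : g q b by rewrite Nq // eqxx orbT.
have ab : a != b.
  apply/eqP => E; subst b; have := @cyc [:: a; p; q].
  rewrite /= gpq gqb [g a p]gs gpa => h; suff : 3 %% 3 = 1 by [].
  apply: h => //.
    by move=> x; rewrite !inE => /or3P[]/eqP->.
  rewrite !inE !negb_or aq [a == p]eq_sym pb /= andbT.
  by apply: contraTneq gpq => ->; rewrite gi.
(* If a and b were adjacent, both neighbours a and q of p would be neighbours of b: a fold. *)
have ngab : ~~ g a b.
  apply/negP => gab; apply: (nofold' p b) => // y yA.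
  by rewrite Np // => /orP[]/eqP->; rewrite gs.
have ctr := indep_contract r_inj gs gi aA pA qA bA dCA aq pb ab ngab Np Nq.
set A' := A :\ p :\ q :\ b in ctr.
have qC : q \notin C by apply: contraL qA => /(disjointFr dCA) ->.
have A'A : A' \subset A :\ p by rewrite /A' setDDl subsetDl.
have := IHn (merge_edges g a b) A' (q |: C) (ltA _ _ pA A'A).
case.
- by move=> x y; rewrite /merge_edges gs [X in _ || X]orbC.
- move=> x; rewrite /merge_edges gi orbb; case: eqVneq => // -> /=.
  by rewrite gs (negPf ngab).
- exact: (contract_cycles gs gi aA pA qA bA aq pb ab Np Nq cyc).
- rewrite disjoints_subset; apply/subsetP => x /setU1P[->|xC]; rewrite !inE ?eqxx ?andbF //.
  by rewrite (disjointFr dCA xC) !andbF.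
- by move=> tr; left=> m; apply/(ctr m).1.
move=> [d dE sd]; right; exists d; last exact: same_homology_sphere ctr sd.
have -> : matching_size g A = (matching_size (merge_edges g a b) A').+2.
  apply/eqP; rewrite eqn_leq.
  rewrite (contract_matching_le gs gi aA qA bA aq pb ab ngab Np Nq).
  exact: (contract_matching_ge gs gi aA pA qA bA aq pb ab ngab Np Nq cyc).
by rewrite -dE cardsU1 qC add1n !addnS doubleS !addSn.
Qed.

End GraphHomology.

(** * The homology groups *)

Local Open Scope ring_scope.
Local Open Scope quotient_scope.

Section QuotientHomology.
Variables (V : finType) (K : complex V).

Definition vrank (v : V) : nat := enum_rank v.

Lemma vrank_inj : injective vrank.
Proof. by move=> u v /ord_inj/enum_rank_inj. Qed.

Lemma chainP n c : reflect (supported (faces K) n c) (chain K n c).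
Proof.
apply: (iffP forallP) => [h F nz|h F]; first by have /implyP/(_ nz)/andP[? /eqP] := h F.
by apply/implyP => /h[-> ->]; rewrite eqxx.
Qed.

(** The faces of a complex are closed under subsets, so the restriction changes nothing. *)
Lemma bd_rbd n c : supported (faces K) n c -> bd c = rbd vrank (faces K) c.
Proof.
move=> sc; apply/ffunP => F; rewrite [RHS]ffunE; case: ifP => FK.
  by rewrite !ffunE; apply: eq_bigr.
rewrite -[LHS]/(fbd vrank c F).
apply/eqP; apply: contraFT FK => /fbd_neq0[v _ /sc[GK _]].
by apply: faces_sub GK _; apply: subsetU1.
Qed.

Lemma cycle_predP n c : reflect (is_cycle vrank (faces K) n c) (c \in cycle_pred K n).
Proof.
apply: (iffP andP) => [[/chainP sc /eqP zc]|[sc zc]]; split=> //.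
- by rewrite -(bd_rbd sc).
- exact/chainP.
- by apply/eqP; rewrite (bd_rbd sc).
Qed.

Lemma boundariesP n (z : cycles K n) :
  reflect (is_boundary vrank (faces K) n (val z)) (z \in @boundaries V K n).
Proof.
apply: (iffP (asboolP _)) => [[b /chainP sb eb]|[b sb eb]]; exists b => //.
- by rewrite -(bd_rbd sb).
- exact/chainP.
- by rewrite (bd_rbd sb).
Qed.

Definition hclass n (z : cycles K n) : homology K n :=
  \pi_(Quotient.quot (@boundaries V K n)) z.

Lemma hclassB n : {morph @hclass n : x y / x - y}.
Proof. by move=> x y; rewrite /hclass raddfB. Qed.

Lemma hclass_surj n (x : homology K n) : exists z, x = hclass z.
Proof. by exists (repr (x : Quotient.quot (@boundaries V K n))); rewrite /hclass reprK. Qed.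

Lemma hclass_eq0 n (z : cycles K n) :
  hclass z = 0 <-> is_boundary vrank (faces K) n (val z).
Proof.
have -> : (0 : homology K n) = hclass 0.
  by have := @hclassB n 0 0; rewrite !subrr.
split=> [/eqP|/boundariesP zB].
  by rewrite /hclass -Quotient.idealrBE subr0 => /boundariesP.
by apply/eqP; rewrite -Quotient.idealrBE subr0.
Qed.

Lemma homology_trivial n : trivial_homology vrank (faces K) n ->
  forall x : homology K n, x = 0.
Proof.
move=> t x; have [z ->] := hclass_surj x.
by apply/hclass_eq0/t/cycle_predP/valP.
Qed.

Lemma homology_int n : cyclic_homology vrank (faces K) n ->
  exists f : {additive int -> homology K n}, bijective f.
Proof.
move=> [z [/cycle_predP Zz gz iz]].
pose zz : cycles K n := Sub z Zz.
pose f (k : int) : homology K n := hclass (zz *~ k).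
have fB : {morph f : x y / x - y} by move=> x y; rewrite /f mulrzBr hclassB.
pose fa : {additive int -> homology K n} :=
  HB.pack f (GRing.isZmodMorphism.Build _ _ f fB).
have vz k : val (zz *~ k) = z *~ k by rewrite raddfMz.
exists fa.
have inj : injective fa.
  move=> x y E; apply/eqP; rewrite -subr_eq0; apply/eqP/iz; rewrite -vz.
  by apply/hclass_eq0; rewrite -[LHS]/(f (x - y)) fB (E : f x = f y) subrr.
have surj x : exists k, fa k = x.
  have [c ->] := hclass_surj x.
  have [k Bk] := gz (val c) (elimT (cycle_predP _ _) (valP c)); exists k.
  apply/esym/eqP; rewrite -subr_eq0; apply/eqP.
  rewrite -[fa k]/(hclass (zz *~ k)) -hclassB.
  by apply/hclass_eq0; rewrite raddfB /= vz.
have [h hK] := choice surj.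
by exists h => // k; apply: inj; rewrite hK.
Qed.

End QuotientHomology.

Lemma additive_bij_comp (M N P : zmodType) (f : {additive P -> M}) (h : {additive P -> N}) :
  bijective f -> bijective h -> exists k : {additive M -> N}, bijective k.
Proof.
move=> [f' fK f'K] bh.
pose k := h \o f'.
have kB : {morph k : x y / x - y}.
  by move=> x y; rewrite /k /= -raddfB; congr (h _); rewrite -{1}[x]f'K -{1}[y]f'K -raddfB fK.
pose ka : {additive M -> N} := HB.pack k (GRing.isZmodMorphism.Build _ _ k kB).
exists ka.
by apply: bij_comp => //; exists f.
Qed.

Lemma additive_bij_trivial (M N : zmodType) :
  (forall x : M, x = 0) -> (forall y : N, y = 0) ->
  exists k : {additive M -> N}, bijective k.
Proof.
move=> M0 N0; pose k (x : M) : N := 0.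
have kB : {morph k : x y / x - y} by move=> x y; rewrite /k subr0.
pose ka : {additive M -> N} := HB.pack k (GRing.isZmodMorphism.Build _ _ k kB).
by exists ka, (fun=> 0) => x; apply/esym; [apply: M0 | apply: N0].
Qed.

Lemma homology_equiv_trivial (V W : finType) (K : complex V) (L : complex W) :
  (forall n, trivial_homology (@vrank V) (faces K) n) ->
  (forall n, trivial_homology (@vrank W) (faces L) n) -> homology_equiv K L.
Proof.
by move=> tK tL n; apply: additive_bij_trivial; apply: homology_trivial.
Qed.

Lemma homology_equiv_sphere (V W : finType) (K : complex V) (L : complex W) d :
  sphere_homology (@vrank V) (faces K) d -> sphere_homology (@vrank W) (faces L) d ->
  homology_equiv K L.
Proof.
move=> [cK tK] [cL tL] n; have [->|/eqP nd] := eqVneq n d.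
  have [f bf] := homology_int cK; have [h bh] := homology_int cL.
  exact: additive_bij_comp bf bh.
by apply: additive_bij_trivial; apply: homology_trivial; [apply: tK | apply: tL].
Qed.

(** Toggling the only vertex cancels both faces. *)
Lemma point_homology n : trivial_homology (@vrank unit) (faces point) n.
Proof.
have h : same_homology (@vrank unit) (faces point) set0.
  apply: (toggle_sub (@vrank_inj unit) (u := tt)).
  - by move=> *; rewrite inE.
  - exact: sub0set.
  - by move=> F _; rewrite !inE.
  - by move=> F G _; rewrite inE.
by apply/(h n).1; apply: homology_set0.
Qed.

(** Toggling [ord0] pairs all proper subsets except the facet opposite to [ord0], whose union with
    [ord0] is the full set; this facet has n elements. *)
Lemma sphere_complex_homology n : sphere_homology (@vrank 'I_n.+1) (faces (sphere n)) n.
Proof.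
have nT : [set~ ord0] != [set: 'I_n.+1] by apply/eqP => /setP/(_ ord0); rewrite !inE.
have h : same_homology (@vrank _) (faces (sphere n)) [set [set~ ord0]].
  apply: (toggle_quotient (@vrank_inj _) (u := ord0)).
  - move=> F G L; rewrite !inE => _ LT _ GL; apply: contra LT => /eqP GT.
    by rewrite -subTset -GT.
  - by apply/subsetP => F; rewrite !inE => /eqP->.
  - move=> F F0; rewrite !inE.
    have FT : F != setT by apply: contraNneq F0 => ->; rewrite inE.
    have F0' : ord0 |: F != [set~ ord0].
      by apply/eqP => /setP/(_ ord0); rewrite !inE eqxx.
    rewrite FT F0' andbT /=; congr (~~ _); apply/eqP/eqP => [->|/setP E].
      by apply/setP => x; rewrite !inE; case: eqVneq.
    apply/setP => x; have := E x; rewrite !inE.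
    by case: eqVneq => [->|_ /=]; [rewrite (negPf F0)|].
  - move=> F G /set1P->; rewrite !inE => GT FG; rewrite eqEsubset FG andbT.
    apply/subsetP => x xG; rewrite !inE; apply: contraNneq GT => x0.
    rewrite -subTset; apply/subsetP => y _; have [->|y0] := eqVneq y ord0.
      by rewrite -x0.
    by apply: (subsetP FG); rewrite !inE.
apply: (same_homology_sphere h).
have cn : #|[set~ (ord0 : 'I_n.+1)]| = n by rewrite cardsC1 card_ord.
split=> [|m /eqP nm]; first by rewrite -[X in cyclic_homology _ _ X]cn; apply: homology_set1_card.
by apply: homology_set1; rewrite cn.
Qed.

Local Close Scope quotient_scope.
Local Close Scope ring_scope.

(** * The incidence graph of a hypergraph *)

Section Incidence.
Variables (V : finType) (H : hypergraph V).

Definition node : finType := (V + {set V})%type.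

Implicit Types (s : seq node) (U Q : {set node}) (e : {set V}) (v : V).

Definition incidence : rel node := fun x y =>
  match x, y with
  | inl v, inr e => v \in e
  | inr e, inl v => v \in e
  | _, _ => false
  end.

(** Subsets of V that are not edges of H stay outside [nodes], hence lie in every complement and
    only shift the grading. *)
Definition nodes : {set node} :=
  [set x : node | match x with inl _ => true | inr e => e \in edges H end].

(** Vertices come before set nodes, so that the latter do not affect the sign attached to a
    vertex. *)
Definition node_rank (x : node) : nat :=
  match x with inl v => enum_rank v | inr e => #|V| + enum_rank e end.

Lemma node_rank_inj : injective node_rank.
Proof.
move=> [v|e] [w|f] /=.
- by move/ord_inj/enum_rank_inj->.
- by move=> E; have := ltn_ord (enum_rank v); rewrite E ltnNge leq_addr.
- by move=> E; have := ltn_ord (enum_rank w); rewrite -E ltnNge leq_addr.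
- by move/addnI/ord_inj/enum_rank_inj->.
Qed.

Lemma incidence_sym : symmetric incidence. Proof. by case=> ? []. Qed.
Lemma incidence_irr : irreflexive incidence. Proof. by case. Qed.

Definition interleave (l : seq (V * {set V})) : seq node :=
  flatten [seq [:: inl p.1; inr p.2] | p <- l].

Definition flag_rel : rel (V * {set V}) := fun p q => (p.1 \in p.2) && (q.1 \in p.2).

Lemma interleave_path p q l :
  path incidence (inl p.1) (inr p.2 :: rcons (interleave l) (inl q.1)) =
  path flag_rel p (rcons l q).
Proof. by elim: l p => [|p' l IH] p /=; rewrite ?andbT // -andbA -IH. Qed.

Lemma interleave_cycle l : cycle incidence (interleave l) = cycle flag_rel l.
Proof. by case: l => // p l; rewrite /= -interleave_path. Qed.

Lemma size_interleave l : size (interleave l) = (size l).*2.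
Proof. by elim: l => //= p l ->. Qed.

Lemma path_interleave s v w : path incidence (inl v) (rcons s (inl w)) ->
  exists l, inl v :: s = interleave l.
Proof.
have [n] := ubnP (size s); elim: n => // n IHn in s v *.
case: s => [|[u|e] [|[v'|e'] s]] //=; try by rewrite ?andbF.
  by move=> _ _; exists [:: (v, e)].
rewrite ltnS => sn /and3P[_ _ p]; have [|l E] := IHn s v' _ p; first exact: ltnW.
by exists ((v, e) :: l); rewrite -[RHS]/[:: inl v, inr e & interleave l] -E.
Qed.

(** Rotated to start at a vertex, a cycle alternates between vertices and edges and is a Berge cycle
    of half its length k. Only k = 2 modulo 3 is left, so its length 2k is 1 modulo 3. *)
Lemma incidence_cycles :
    (forall k, k = 0 %[mod 3] \/ k = 1 %[mod 3] -> ~ has_berge_cycle H k) ->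
  cycles_mod3 incidence nodes.
Proof.
move=> noBerge s sA us cs sz.
have [v vs] : exists v, inl v \in s.
  case: s sz cs {sA us} => [//|[v|e] [//|[w|f] s]] _; try by exists v; rewrite inE eqxx.
    by exists w; rewrite !inE eqxx orbT.
  by [].
have [i s' rE] := rot_to vs.
move: us cs sz; rewrite -(rot_uniq i) -(rot_cycle i) -(size_rot i) rE.
have {}sA : {subset inl v :: s' <= nodes} by move=> x; rewrite -rE mem_rot; apply: sA.
move=> us cs; have [l E] := path_interleave cs.
move: us cs sA; rewrite E size_interleave interleave_cycle => us cs sA sz.
have u1 : uniq (map fst l).
  rewrite -(map_inj_uniq (f := (inl : V -> node))); last by move=> ? ? [].
  apply: subseq_uniq us; elim: (l) => //= p l' IH.
  by rewrite eqxx; apply: subseq_trans IH (subseq_cons _ _).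
have u2 : uniq (map snd l).
  rewrite -(map_inj_uniq (f := (inr : {set V} -> node))); last by move=> ? ? [].
  apply: subseq_uniq us; elim: (l) => //= p l' IH.
  by rewrite eqxx.
have lH p : p \in l -> p.2 \in edges H.
  move=> pl; have : inr p.2 \in nodes.
    apply: sA; elim: (l) pl => //= p' l' IH; rewrite !inE => /orP[/eqP->|/IH->].
      by rewrite eqxx.
    by rewrite !orbT.
  by rewrite inE.
case: l => [//|p0 l0] in us cs lH u1 u2 sz {E sA} *.
set l := p0 :: l0 in us cs lH u1 u2 sz *.
set k := size l.
have k2 : 2 <= k by rewrite /k; move: sz; rewrite /l; case: (l0) => [|? ?].
have berge : has_berge_cycle H k.
  split=> //; exists (fun i : 'I_k => nth p0.1 (map fst l) i),
    (fun i : 'I_k => nth p0.2 (map snd l) i); split.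
  - move=> x y /eqP; rewrite nth_uniq ?size_map // => /eqP; exact: ord_inj.
  - move=> x y /eqP; rewrite nth_uniq ?size_map // => /eqP; exact: ord_inj.
  - move=> x; have xk : x < size l by apply: ltn_ord.
    have xk' : x.+1 %% k < size l by rewrite ltn_pmod.
    rewrite !(nth_map p0) //=.
    have /(pathP p0)/(_ x) : path flag_rel p0 (rcons l0 p0) by [].
    rewrite size_rcons => /(_ xk); rewrite /flag_rel.
    have -> : nth p0 (p0 :: rcons l0 p0) x = nth p0 l x.
      by rewrite -rcons_cons nth_rcons xk.
    (* The last position is followed by position 0, the head [p0] appended to close the cycle. *)
    have -> : nth p0 (rcons l0 p0) x = nth p0 l (x.+1 %% k).
      rewrite nth_rcons; move: xk; rewrite /= ltnS leq_eqVlt => /orP[/eqP E|xl].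
        by rewrite E ltnn eqxx /k modnn.
      by rewrite xl modn_small.
    by case/andP=> ? ?; split=> //; apply/lH/mem_nth.
rewrite -muln2 -modnMml; have := ltn_pmod k (isT : 0 < 3).
have := noBerge k; case E: (k %% 3) => [|[|[|]]] // h _.
  by case: h => //; left.
by case: h => //; right.
Qed.

Lemma gamma_attained : exists2 W, dominating H W & #|W| = gamma H.
Proof.
rewrite /gamma; case: arg_minnP => [|W dW _]; first exact: dominating_setT.
by exists W.
Qed.

Lemma gamma_min W : dominating H W -> gamma H <= #|W|.
Proof.
move=> dW; rewrite /gamma; case: arg_minnP => [|W' _]; first exact: dominating_setT.
exact.
Qed.

(* W is dominating iff every vertex v outside W has an edge e with e \ W = {v},
   that is iff ~: W is the V-side of an induced matching. *)
Lemma matching_size_gamma : matching_size incidence nodes = (#|V| - gamma H).*2.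
Proof.
apply/eqP; rewrite eqn_leq; apply/andP; split.
  apply: matching_size_geP => S mS; have /induced_matchingP[SA h] := mS.
  pose U := [set v | inl v \in S].
  have dU : dominating H (~: U).
    apply/forallP => v; rewrite /dominates inE.
    have [vU|//] := boolP (v \in U); rewrite /=.
    have vS : inl v \in S by rewrite inE in vU.
    have [[w|e] [eS ve _]] := h _ vS; first by [].
    apply/existsP; exists (e :\ v); rewrite setD1K //.
    have := SA _ eS; rewrite inE => ->; rewrite andbT.
    apply/subsetP => w /setD1P[wv we]; rewrite !inE; apply: contra wv => wS.
    suff [->] : inl w = inl v :> node by [].
    by apply: (induced_matching_partner mS eS).
  have le2 : #|[set e | inr e \in S]| <= #|U|.
    (* If v is the partner of an edge node in S, the choice can only return that edge; so the edge
       side of S lies in the image of U. *)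
    pose f v : {set V} := odflt set0 [pick e | (inr e \in S) && (v \in e)].
    apply: leq_trans (leq_imset_card f U); apply: subset_leq_card.
    apply/subsetP => e; rewrite inE => eS; have [[v|e'] [vS ve _]] := h _ eS; last by [].
    apply/imsetP; exists v; rewrite ?inE // /f; case: pickP => [e' /andP[e'S ve']|] /=.
      have [//] : inr e = inr e' :> node.
      by apply: (induced_matching_partner mS vS).
    have {}ve : v \in e := ve.
    by move/(_ e); rewrite eS ve.
  have -> : #|S| = #|U| + #|[set e | inr e \in S]|.
    have iU : #|inl @: U : {set node}| = #|U| by apply: card_imset => ? ? [].
    have iE : #|inr @: [set e | inr e \in S] : {set node}| = #|[set e | inr e \in S]|.
      by apply: card_imset => ? ? [].
    rewrite -iU -iE -cardsUI; set X := _ :&: _.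
    have -> : X = set0.
      by apply/setP => x; rewrite !inE; apply/andP => -[/imsetP[v _ ->] /imsetP[]].
    rewrite cards0 addn0; apply: eq_card => -[v|e]; rewrite inE.
      rewrite mem_imset ?inE //; last by move=> ? ? [].
      by case: (_ \in S) => //=; apply/esym/imsetP => -[].
    rewrite orbC mem_imset ?inE //; last by move=> ? ? [].
    by case: (_ \in S) => //=; apply/esym/imsetP => -[].
  have := gamma_min dU; have := cardsC U; rewrite -[#|~: U|]/(#|~: U|); lia.
have [W dW <-] := gamma_attained; set U := ~: W.
have -> : #|V| - #|W| = #|U| by have := cardsC W; rewrite -/U; lia.
(* For v outside W, domination supplies such an edge, so the default is never taken on U. *)
pose f v : {set V} := odflt set0 [pick e | [&& e \in edges H, v \in e & e :\ v \subset W]].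
have fP v : v \in U -> [/\ f v \in edges H, v \in f v & f v :\ v \subset W].
  move=> vU; rewrite /f; case: pickP => [e /and3P[]//|none].
  have := forallP dW v; rewrite /dominates; rewrite inE in vU; rewrite (negPf vU) /=.
  case/existsP=> W' /andP[sW eH]; have := none (v |: W'); rewrite eH setU11 /=.
  case/negP; apply/subsetP => w /setD1P[wv /setU1P[wv'|wW']].
    by rewrite wv' eqxx in wv.
  exact: (subsetP sW).
have fU v w : v \in U -> w \in U -> w \in f v -> w = v.
  move=> vU wU wf; apply/eqP; apply: contraT => wv; have [_ _ /subsetP s] := fP _ vU.
  by rewrite inE (s w) // in wU; rewrite !inE wv.
pose S : {set node} := (inl @: U) :|: [set inr (f v) | v in U].
have inS v : (inl v \in S) = (v \in U).
  rewrite inE mem_imset; last by move=> ? ? [].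
  by case: (v \in U) => //=; apply/imsetP => -[].
have frS e : inr e \in S -> exists2 v, v \in U & e = f v.
  by rewrite inE => /orP[/imsetP[]//|/imsetP[v vU [->]]]; exists v.
have rS v : v \in U -> inr (f v) \in S.
  by move=> vU; rewrite inE orbC (imset_f (fun v => inr (f v))).
have <- : #|S| = (#|U|).*2.
  rewrite cardsU; set X := _ :&: _.
  have -> : X = set0.
    by apply/setP => x; rewrite !inE; apply/andP => -[/imsetP[v _ ->] /imsetP[]].
  rewrite cards0 subn0 card_imset; last by move=> ? ? [].
  rewrite card_in_imset ?addnn // => v w vU wU [E]; apply: fU => //.
  by rewrite -E; case: (fP _ vU).
apply/leq_matching_size/induced_matchingP; split.
  move=> [v|e] xS; rewrite inE // ; have [v vU ->] := frS _ xS.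
  by case: (fP _ vU).
move=> [v|e] xS.
  have vU : v \in U by rewrite -inS.
  exists (inr (f v)); rewrite rS //; split=> //=; first by case: (fP _ vU).
  move=> [//|e] /frS[w wU ->] /= vw; by rewrite (fU w v).
have [v vU ->] := frS _ xS.
exists (inl v); rewrite inS vU; split=> //=; first by case: (fP _ vU).
by move=> [w|//]; rewrite inS => wU /= /(fU _ _ vU wU)->.
Qed.

(* When the edge e is added to l, the sets lost are those disjoint from e; they
   cancel in pairs by toggling the node e. *)
Definition meeting_family (l : seq {set V}) : pred {set node} := fun U =>
  indep_family incidence set0 nodes U &&
  all (fun e => [exists v, (v \in e) && (inl v \in U)]) l.

Lemma meeting_homology l : {subset l <= edges H} ->
  same_homology node_rank (cofamily (indep_family incidence set0 nodes))
    (cofamily (meeting_family l)).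
Proof.
elim: l => [|e l IH] lH.
  rewrite (@eq_cofamily _ _ (meeting_family [::])); last first.
    by move=> U; rewrite /meeting_family andbT.
  by move=> n.
apply: same_homology_trans (IH _) _; first by move=> x xl; apply: lH; rewrite inE xl orbT.
have eH : e \in edges H by apply: lH; rewrite inE eqxx.
have RE U : meeting_family (e :: l) U =
    meeting_family l U && [exists v, (v \in e) && (inl v \in U)].
  by rewrite /meeting_family /= -andbA; congr (_ && _); rewrite andbC.
have meetU (x : {set V}) U : [exists v, (v \in x) && (inl v \in inr e |: U)] =
    [exists v, (v \in x) && (inl v \in U)].
  by apply: eq_existsb => v; rewrite !inE.
have allU U : all (fun x : {set V} => [exists v, (v \in x) && (inl v \in inr e |: U)]) l =
    all (fun x : {set V} => [exists v, (v \in x) && (inl v \in U)]) l.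
  by apply: eq_all => x; apply: meetU.
have mono (x : {set V}) U U' : U \subset U' -> [exists v, (v \in x) && (inl v \in U)] ->
    [exists v, (v \in x) && (inl v \in U')].
  move=> /subsetP s /existsP[v /andP[vx vU]]; apply/existsP; exists v.
  by rewrite vx s.
apply: (@cofamily_toggle _ _ node_rank_inj _ _ (inr e)).
- move=> U1 U2 U3 /andP[i1 a1] /andP[i3 a3] s12 s23; apply/andP; split.
    exact: indep_family_closed i1 i3 s12 s23.
  by apply/allP => x /(allP a1); apply: mono.
- by move=> U; rewrite RE => /andP[].
- move=> U eU PU; rewrite !RE PU /= meetU => nm; rewrite negb_and nm orbT andbT.
  have /andP[/indep_familyP[_ UA ind] aU] := PU.
  have noe y : y \in U -> ~~ incidence (inr e) y.
    case: y => [v|//] vU /=; apply: contra nm => ve; apply/existsP; exists v.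
    by rewrite ve.
  apply/andP; split; last by rewrite allU.
  apply/indep_familyP; split.
  - by move=> x; rewrite inE.
  - by move=> x /setU1P[->|/UA //]; right; rewrite inE.
  - move=> x y /setU1P[->|xU] xA /setU1P[->|yU] yA; [by []|exact: noe| |exact: ind].
    by rewrite incidence_sym noe.
- move=> U eU PU; rewrite !RE PU /= meetU => nm; rewrite negb_and nm orbT andbT.
  have /andP[/indep_familyP[_ UA ind] aU] := PU.
  apply/andP; split; last by rewrite -allU.
  apply/indep_familyP; split=> [x|x xU|x y xU xA yU yA]; first by rewrite inE.
    by apply: UA; rewrite inE xU orbT.
  by apply: ind; rewrite // inE ?xU ?yU orbT.
- right=> U U'; rewrite !RE => /andP[PU mU] -> s /=; exact: mono mU.
Qed.

Definition extend (S : {set V}) : {set node} :=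
  [set x : node | match x with inl v => v \in S | inr _ => true end].

Lemma extend_inj : injective extend.
Proof. by move=> S S' /setP E; apply/setP => v; have := E (inl v); rewrite !inE. Qed.

Lemma meeting_family_extend :
  cofamily (meeting_family (enum (edges H))) = extend @: faces (indep_complex H).
Proof.
apply/setP => Q; rewrite inE; apply/idP/imsetP => [/andP[/indep_familyP[_ UA ind] aU]|].
  have QE : Q = extend [set v | inl v \in Q].
    apply/setP => -[v|e]; rewrite !inE //; apply: contraT => eQ.
    have eU : inr e \in ~: Q by rewrite inE.
    have eA : inr e \in nodes by have [|//] := UA _ eU; rewrite inE.
    have eH : e \in enum (edges H) by rewrite mem_enum; rewrite inE in eA.
    have /existsP[v /andP[ve vU]] := allP aU _ eH.
    have := ind (inr e) (inl v) eU eA vU; rewrite inE => /(_ isT).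
    by rewrite /= ve.
  exists [set v | inl v \in Q] => //; rewrite inE; apply/forall_inP => e eH.
  have eH' : e \in enum (edges H) by rewrite mem_enum.
  have /existsP[v /andP[ve vU]] := allP aU _ eH'.
  by apply/subsetPn; exists v => //; move: vU; rewrite !inE.
move=> [S]; rewrite inE => /forall_inP iS ->; apply/andP; split.
  apply/indep_familyP; split=> [x|[v|e]|[v|e] [w|f]]; rewrite ?inE //.
  by right.
apply/allP => e; rewrite mem_enum => /iS /subsetPn[v ve vS].
by apply/existsP; exists v; rewrite ve !inE.
Qed.

Local Open Scope ring_scope.

Definition extend_chain (c : {ffun {set V} -> int}) : {ffun {set node} -> int} :=
  [ffun Q : {set node} => if Q == extend [set v | inl v \in Q] then c [set v | inl v \in Q] else 0].

Lemma extendK S : [set v | inl v \in extend S] = S.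
Proof. by apply/setP => v; rewrite !inE. Qed.

Lemma extend_chainE c S : extend_chain c (extend S) = c S.
Proof. by rewrite ffunE extendK eqxx. Qed.

Lemma extend_chain_neq0 c Q : extend_chain c Q != 0 ->
  exists2 S, Q = extend S & c S != 0.
Proof.
rewrite ffunE; case: ifP => [/eqP E cS|_]; last by rewrite eqxx.
by exists [set v | inl v \in Q].
Qed.

Lemma card_extend S : #|extend S| = (#|S| + #|{set V}|)%N.
Proof.
have -> : extend S = (inl @: S) :|: (inr @: [set: {set V}]).
  apply/setP => -[v|e]; rewrite !inE.
    rewrite mem_imset; last by move=> ? ? [].
    by case: (v \in S) => //=; apply/esym/imsetP => -[].
  by apply/esym/orP; right; apply: imset_f.
rewrite cardsU; set X := _ :&: _.
have -> : X = set0.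
  by apply/setP => x; rewrite !inE; apply/andP => -[/imsetP[v _ ->] /imsetP[]].
by rewrite cards0 subn0 !card_imset ?cardsT // => ? ? [].
Qed.

Lemma sgn_extend S v : sgn node_rank (extend S) (inl v) = sgn (@vrank V) S v.
Proof.
rewrite /sgn; congr (_ ^+ _).
have -> : [set u in extend S | (node_rank u < node_rank (inl v))%N] =
    inl @: [set u in S | (vrank u < vrank v)%N].
  apply/setP => -[u|e]; rewrite !inE /=; first by rewrite mem_imset ?inE // => ? ? [].
  rewrite ltnNge ltnW ?(leq_trans (ltn_ord _)) ?leq_addr //.
  by apply/esym/imsetP => -[].
by rewrite card_imset // => ? ? [].
Qed.

(** [extend S] contains all set nodes, so only vertices can be added to it. *)
Lemma fbd_extend (c : {ffun {set node} -> int}) S :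
  fbd node_rank c (extend S) =
  fbd (@vrank V) [ffun S' : {set V} => c (extend S')] S.
Proof.
rewrite !ffunE (reindex_omap (inl : V -> node)
  (fun x : node => if x is inl v then Some v else None)) /=; last first.
  by case=> [v|e]; rewrite inE.
apply: eq_big => v; first by rewrite inE eqxx andbT.
move=> _; rewrite sgn_extend ffunE; congr (_ * c _).
by apply/setP => -[w|e]; rewrite !inE.
Qed.

(** Extension adds all [#|{set V}|] set nodes to each set; this constant is the shift in degree. *)
Lemma extend_homology (X : {set {set V}}) n :
  (trivial_homology (@vrank V) X n <->
   trivial_homology node_rank (extend @: X) (n + #|{set V}|)) /\
  (cyclic_homology (@vrank V) X n <->
   cyclic_homology node_rank (extend @: X) (n + #|{set V}|)).
Proof.
have memE S : (extend S \in extend @: X) = (S \in X).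
  by rewrite mem_imset //; apply: extend_inj.
pose back (c : {ffun {set node} -> int}) := [ffun S : {set V} => c (extend S)].
have backK c : back (extend_chain c) = c.
  by apply/ffunP => S; rewrite ffunE extend_chainE.
have extK m c : supported (extend @: X) m c -> extend_chain (back c) = c.
  move=> sc; apply/ffunP => Q; have [c0|cQ] := eqVneq (c Q) 0.
    by rewrite c0 ffunE; case: ifP => // /eqP E; rewrite ffunE -E.
  have [/imsetP[S _ ->] _] := sc _ cQ.
  by rewrite extend_chainE ffunE.
have rE c : rbd node_rank (extend @: X) (extend_chain c) = extend_chain (rbd (@vrank V) X c).
  apply/ffunP => Q; rewrite ffunE; case: ifP => [/imsetP[S SX ->]|nQ].
    by rewrite extend_chainE fbd_extend -/(back _) backK [RHS]ffunE SX.
  apply/esym/eqP; apply: contraFT nQ => /extend_chain_neq0[S ->].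
  by rewrite memE ffunE; case: ifP.
have ext_inj c c' : extend_chain c = extend_chain c' -> c = c'.
  by move=> E; rewrite -(backK c) E backK.
have ext0 : extend_chain 0 = 0.
  by apply/ffunP => Q; rewrite !ffunE if_same.
have sE m c : supported X m c -> supported (extend @: X) (m + #|{set V}|) (extend_chain c).
  move=> sc Q /extend_chain_neq0[S -> /sc[SX <-]].
  by rewrite memE card_extend.
have sB m c : supported (extend @: X) (m + #|{set V}|) c -> supported X m (back c).
  move=> sc S; rewrite ffunE => /sc; rewrite memE card_extend => -[SX /eqP].
  by rewrite eqn_add2r => /eqP.
apply: (@quasi_iso _ _ extend_chain).
- by move=> x y; apply/ffunP => Q; rewrite !ffunE; case: ifP; rewrite ?subr0.
- exact: is_cycle0.
- exact: is_boundary0.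
- exact: is_cycleB.
- exact: is_boundaryB.
- by move=> c [sc zc]; split; [exact: sE | rewrite rE zc ext0].
- move=> c _; split=> -[b sb eb].
    by exists (extend_chain b); [apply: (sE n.+1) | rewrite rE eb].
  have sb' : supported X n.+1 (back b) by apply: sB.
  by exists (back b) => //; apply: ext_inj; rewrite -rE (extK _ _ sb).
- move=> c' [sc zc]; exists (back c'); last by rewrite (extK _ _ sc) subrr; apply: is_boundary0.
  split; first exact: sB.
  by apply: ext_inj; rewrite -rE (extK _ _ sc) zc ext0.
Qed.

End Incidence.

Theorem theorem1p4 (V : finType) (H : hypergraph V)
  (noBerge : forall k : nat, k = 0 %[mod 3] \/ k = 1 %[mod 3] ->
    ~ has_berge_cycle H k) :
  homology_equiv (indep_complex H) point \/
  homology_equiv (indep_complex H) (sphere (gamma H)).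
Proof.
have dA : [disjoint (set0 : {set node V}) & nodes H] by rewrite disjoints_subset sub0set.
have lH : {subset enum (edges H) <= edges H} by move=> e; rewrite mem_enum.
have same := meeting_homology lH; rewrite meeting_family_extend in same.
have tr n : trivial_homology (@node_rank V) (@extend V @: faces (indep_complex H)) (n + #|{set V}|) ->
    trivial_homology (@vrank V) (faces (indep_complex H)) n.
  by move=> t; apply/(extend_homology _ n).1.
case: (graph_homology (@node_rank_inj V) (@incidence_sym V) (@incidence_irr V)
         (incidence_cycles noBerge) dA) => [t|[d dE [cd td]]].
  left; apply: homology_equiv_trivial; last exact: point_homology.
  by move=> n; apply/tr/(same _).1/t.
right; apply: (homology_equiv_sphere (d := gamma H)); last exact: sphere_complex_homology.
(* With this bound the truncated difference in [matching_size_gamma] is a genuine one. *)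
have gV : gamma H <= #|V|.
  by have := gamma_min (dominating_setT H); rewrite cardsT.
(* There are [#|V| + #|{set V}|] nodes and [#|V| - gamma H] matching edges, so [#|V|] cancels. *)
have {}dE : d = (gamma H + #|{set V}|)%N.
  move: dE; rewrite cards0 addn0 matching_size_gamma -doubleD => /double_inj.
  have -> : #|node V| = (#|V| + #|{set V}|)%N by rewrite card_sum.
  lia.
split=> [|n nd]; first by apply/(extend_homology _ _).2/(same _).2; rewrite -dE.
apply/tr/(same _).1/td; rewrite dE => /eqP; rewrite eqn_add2r => /eqP; exact: nd.
Qed.
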